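(* Let $1\le d<\infty$ and let $(X,\rho,\mu)$ be a doubling metric measure space having lower dimension $d$ and supporting the $(1,d)$-Poincaré inequality. If $0<p\le d$ and $f\in L^p_{\mathrm{loc}}(\mu)$ satisfies $$\Big[(x,y)\mapsto\frac{|f(x)-f(y)|^p}{V(x,y)^2}\Big]\in L^1_{\mathrm{loc}}(\mu\times\mu),$$ then $f$ is equal to a constant $\mu$-almost everywhere. In particular, for all $p\in(0,d]$, $$\dot B^p(\mu):=\Big\{f\in L^p_{\mathrm{loc}}(\mu):\iint_{X\times X}|f(x)-f(y)|^p\frac{d\mu(x)\,d\mu(y)}{V(x,y)^2}<\infty\Big\}=\{\text{constants}\}.$$
   Context: A metric measure space $(X,\rho,\mu)$ is doubling if there is a constant $c_\mu$ with $\mu(B(x,2r))\le c_\mu\,\mu(B(x,r))$ for all $x\in X$, $r>0$, where $B(x,r)=\{y:\rho(x,y)<r\}$; as usual, all balls have positive and finite measure. Completeness is not assumed. $V(x,r):=\mu(B(x,r))$ and $V(x,y):=\mu(B(x,\rho(x,y)))$; the integrands above are understood to vanish when $x=y$. $L^q_{\mathrm{loc}}(\mu)$ is the class of measurable $f$ with $1_Bf\in L^q(\mu)$ for every ball $B$; $L^1_{\mathrm{loc}}(\mu\times\mu)$ means integrability over $B\times B$ for every ball $B\subset X$. $\langle f\rangle_B:=\frac1{\mu(B)}\int_Bf\,d\mu$. ''Constants'' means functions equal to a constant $\mu$-a.e. Lower dimension $d$: $\big(\frac Rr\big)^d\le C\,\frac{V(x,R)}{V(x,r)}$ for some constant $C$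 and all $x\in X$ and $0<r\le R<2\operatorname{diam}(X)$. Pointwise Lipschitz constant: $\operatorname{lip}f(x):=\liminf_{t\to0}\sup_{\rho(x,y)\le t}\frac{|f(x)-f(y)|}{t}$. $(1,d)$-Poincaré inequality: there are constants $\lambda\in[1,\infty)$ and $c_P\in(0,\infty)$ such that $$\frac{1}{\mu(B(z,r))}\int_{B(z,r)}|f-\langle f\rangle_{B(z,r)}|\,d\mu\le c_P\, r\Big(\frac{1}{\mu(B(z,\lambda r))}\int_{B(z,\lambda r)}(\operatorname{lip}f)^d\,d\mu\Big)^{1/d}$$ for all $z\in X$, $r>0$ and all Lipschitz functions $f$ on $X$. *)

(* Defs.v *)
From HB Require Import structures.
From mathcomp Require Import all_boot all_order all_algebra.
From mathcomp Require Import all_classical all_reals all_analysis.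

Set Implicit Arguments.
Unset Strict Implicit.
Unset Printing Implicit Defensive.

Import Order.TTheory GRing.Theory Num.Theory.
Import numFieldNormedType.Exports.

Local Open Scope classical_set_scope.
Local Open Scope ring_scope.

(* Metric spaces whose measurable sets are exactly the Borel sets; the measure
   of a metric measure space is a [{measure set X -> \bar R}] on such an [X]. *)
HB.mixin Record Metric_isBorel (disp : measure_display) (R : realType) X
    & Metric R X & Measurable disp X := {
  measurable_borelE : @measurable disp X = <<s @open X >>
}.

#[short(type="borelMetricType")]
HB.structure Definition BorelMetric (disp : measure_display) (R : realType) :=
  { X of Metric R X & Measurable disp X & Metric_isBorel disp R X }.

Section metric_measure_space.
Context (disp : measure_display) (R : realType) (X : borelMetricType disp R).
Implicit Types (f : X -> R) (x y z : X) (r s t d p q : R).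

Definition diameter : \bar R :=
  ereal_sup [set (mdist x y)%:E | x in [set: X] & y in [set: X]].

Definition lipschitz_fun f : Prop :=
  exists L : R, forall x y, `|f x - f y| <= L * mdist x y.

(* The limit inferior is over positive [t]; the value is an extended real since
   the supremum over the closed ball may be infinite for a general [f]. *)
Definition lip f x : \bar R :=
  limf_einf (fun t => ereal_sup
    [set (`|f x - f y| / t)%:E | y in [set y | mdist x y <= t]]) 0^'+.

Variable mu : {measure set X -> \bar R}.

Definition balls_pos_finite : Prop :=
  forall x r, 0 < r -> (0 < mu (ball x r) < +oo)%E.

Definition doubling : Prop :=
  exists c : R, forall x r, 0 < r ->
    (mu (ball x (2 * r)) <= c%:E * mu (ball x r))%E.

Definition Vball x r : R := fine (mu (ball x r)).

Definition Vdist x y : R := Vball x (mdist x y).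

Definition lower_dimension d : Prop :=
  exists C : R, forall x r s, 0 < r -> r <= s -> (s%:E < 2%:E * diameter)%E ->
    (s / r) `^ d <= C * (Vball x s / Vball x r).

Definition ball_average f x r : R :=
  (Vball x r)^-1 * \int[mu]_(y in ball x r) f y.

Definition poincare1 d : Prop :=
  exists lambda cP : R, [/\ 1 <= lambda, 0 < cP &
    forall z r f, 0 < r -> lipschitz_fun f ->
      ((Vball z r)^-1%:E *
         \int[mu]_(x in ball z r) `|f x - ball_average f z r|%:E
       <= (cP * r)%:E *
          ((Vball z (lambda * r))^-1%:E *
            \int[mu]_(x in ball z (lambda * r)) (lip f x `^ d)) `^ d^-1)%E].

(* [Lfun mu q%:E] is the set of measurable functions with finite
   [(\int |f| `^ q) `^ q^-1]; this is meant for every [0 < q], also [q < 1]. *)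
Definition Lloc q f : Prop :=
  measurable_fun [set: X] f /\
  forall x r, 0 < r -> (\1_(ball x r) \* f) \in Lfun mu q%:E.

Definition L1loc_prod (g : X * X -> R) : Prop :=
  forall x r, 0 < r ->
    (mu \x mu)%E.-integrable (ball x r `*` ball x r) (EFin \o g).

Definition besov_integrand p f (w : X * X) : R :=
  if w.1 == w.2 then 0
  else `|f w.1 - f w.2| `^ p / Vdist w.1 w.2 ^+ 2.

Definition ae_constant f : Prop := exists c : R, {ae mu, forall x, f x = c}.

Definition besov p : set (X -> R) :=
  [set f | Lloc p f /\
           (\int[mu \x mu]_w (besov_integrand p f w)%:E < +oo)%E].

(* Only measurable functions are considered; as [mu] need not be complete, an
   almost everywhere constant function is not automatically measurable. *)
Definition constants : set (X -> R) :=
  [set f | measurable_fun [set: X] f /\ ae_constant f].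

End metric_measure_space.

(* Main.v *)
(* Set T := u / (1 + |u|), a bounded, injective, 2-Lipschitz function of u.  As
   p <= d, the function g := T(f) satisfies |g(x) - g(y)|^d <= 2^d |f(x) - f(y)|^p,
   so it suffices to show that a bounded g with |g(x) - g(y)|^d / V(x,y)^2 locally
   integrable is a.e. constant.  Let F_t be the average of g against the kernel
   max(0, 2t - rho(x,y)), and osc(x) the mean of |g(y) - g(x)| over y in B(x,3t).
   Doubling gives |F_t(x) - g(x)| <= K osc(x) and lip F_t(x) <= K osc(x) / t.  By
   Jensen and V(x,y) <= V(x,3t) on the ball,
     osc(x)^d <= V(x,3t) * int_{B(x,3t)} |g(x) - g(y)|^d / V(x,y)^2 dmu(y),
   and the lower dimension bounds V(x,3t) by a multiple of t^d locally uniformly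
   in x.  Hence (lip F_t)^d is at most a constant times a tail integral near the
   diagonal, which tends to 0 with t in L^1 by dominated convergence, and F_t
   tends to g a.e.  The Poincare inequality applied to F_t then shows that g
   equals its average a.e. on every ball. *)
Require Import Defs.
From HB Require Import structures.
From mathcomp Require Import all_boot all_order all_algebra.
From mathcomp Require Import all_classical all_reals all_analysis.
From mathcomp Require Import measurable_realfun finmap ring lra.

Set Implicit Arguments.
Unset Strict Implicit.
Unset Printing Implicit Defensive.

Import Order.TTheory GRing.Theory Num.Theory.
Import numFieldNormedType.Exports.

Local Open Scope classical_set_scope.
Local Open Scope ring_scope.

(** * Balls, Lipschitz functions and the pointwise Lipschitz constant *)

Section borel_metric.
Context (disp : measure_display) (R : realType) (X : borelMetricType disp R).
Implicit Types (x y z : X) (r s t e : R) (f : X -> R).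

Lemma open_measurable_borel (A : set X) : open A -> measurable A.
Proof. by move=> oA; rewrite measurable_borelE; exact: sub_sigma_algebra. Qed.

Lemma in_ballE x r y : ball x r y = (mdist x y < r) :> Prop.
Proof. by rewrite ballEmdist. Qed.

Lemma subset_ball_mdist x y r s : mdist x y + s <= r -> ball y s `<=` ball x r.
Proof.
move=> rs w; rewrite !in_ballE => yw.
by rewrite (le_lt_trans (metric_triangle x y w))// (lt_le_trans _ rs)// ltrD2l.
Qed.

Lemma open_mdistP (A : set X) :
  (forall x, A x -> exists2 e, 0 < e & ball x e `<=` A) -> open A.
Proof.
move=> h; rewrite openE => x /h[e e0 xA]; rewrite /interior.
by apply: filterS xA _; exact: nbhsx_ballx.
Qed.

Lemma measurable_metric_ball x r : measurable (ball x r).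
Proof.
apply/open_measurable_borel/open_mdistP => y; rewrite in_ballE => xy.
exists (r - mdist x y); first by rewrite subr_gt0.
by apply: subset_ball_mdist; rewrite subrKC.
Qed.

Lemma lipschitz_measurable f : lipschitz_fun f -> measurable_fun setT f.
Proof.
move=> [L fL]; apply: (measurability _ (RGenOInfty.measurableE R)) => //.
move=> _ [_ [a ->] <-]; apply: open_measurable_borel.
rewrite setTI; apply: open_mdistP => x /=; rewrite in_itv/= andbT => afx.
(* The given [L] may be zero or negative, so the radius is computed with the positive constant
   [|L| + 1]. *)
have L0 : 0 < `|L| + 1 by rewrite ltr_wpDl.
exists ((f x - a) / (`|L| + 1)); first by rewrite divr_gt0// subr_gt0.
move=> y; rewrite in_ballE ltr_pdivlMr//= in_itv/= andbT => xy.
have : `|f x - f y| < f x - a.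
  apply: le_lt_trans (fL x y) _; apply: le_lt_trans xy.
  rewrite mulrC ler_wpM2l// ?mdist_ge0// (le_trans (ler_norm L))// lerDl//.
by move=> /(le_lt_trans (ler_norm _)); rewrite ltrD2l ltrN2.
Qed.

Lemma mdist_lipschitz z x y : `|mdist z x - mdist z y| <= mdist x y.
Proof.
rewrite ler_norml; apply/andP; split.
  by rewrite lerNl opprB lerBlDl metric_triangle.
by rewrite lerBlDl (metric_sym x y) metric_triangle.
Qed.

Lemma measurable_mdist z : measurable_fun setT (mdist z).
Proof.
apply: lipschitz_measurable; exists 1 => x y; rewrite mul1r.
exact: mdist_lipschitz.
Qed.

Lemma lip_ge0 f x : (0 <= lip f x)%E.
Proof.
pose F (t : R) : \bar R :=
  ereal_sup [set (`|f x - f y| / t)%:E | y in [set y | mdist x y <= t]].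
rewrite /lip limf_einfE; apply: (@le_trans _ _ (ereal_inf (F @` [set t | 0 < t]))).
  apply: le_ereal_inf_tmp => _ [t /= t0 <-]; apply: ereal_sup_ubound; exists x => /=.
    by rewrite mdistxx ltW.
  by rewrite subrr normr0 mul0r.
apply: ereal_sup_ubound; exists [set t : R | 0 < t] => //.
exact: nbhs_right_gt.
Qed.

(** A lower limit is controlled by single small radii: every right neighbourhood of 0 contains some
    [t < e], and the supremum at that [t] is at most [L]. *)
Lemma lip_le f x L e : 0 < e -> 0 <= L ->
  (forall y, mdist x y <= e -> `|f x - f y| <= L * mdist x y) ->
  (lip f x <= L%:E)%E.
Proof.
move=> e0 L0 fL; rewrite /lip limf_einfE; apply: ge_ereal_sup => _ [U + <-].
move=> /(filterI (nbhs_right_lt e0))/(filterI (nbhs_right_gt 0)).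
move=> /filter_ex[t [/= t0 [te Ut]]].
apply: (@le_trans _ _ (ereal_sup
    [set (`|f x - f y| / t)%:E | y in [set y | mdist x y <= t]])).
  by apply: ereal_inf_lbound; exists t.
apply: ge_ereal_sup => _ [y /= xyt <-]; rewrite lee_fin ler_pdivrMr//.
rewrite (le_trans (fL y _)) ?ler_wpM2l//.
by rewrite (le_trans xyt)// ltW.
Qed.

End borel_metric.

(** * Separability and joint measurability on the product space *)

Section ball_measure.
Context (disp : measure_display) (R : realType) (X : borelMetricType disp R).
Variable mu : {measure set X -> \bar R}.
Hypothesis mu_balls : balls_pos_finite mu.
Implicit Types (x y z : X) (r s t e : R).

Lemma ball_fin_num x r : mu (ball x r) \is a fin_num.
Proof.
have [r0|r0] := ltP 0 r; first by have /andP[? ?] := mu_balls x r0; rewrite ge0_fin_numE.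
rewrite (_ : ball x r = set0) ?measure0// -subset0 => y.
by rewrite in_ballE => /lt_le_trans /(_ r0); rewrite ltNge mdist_ge0.
Qed.

Lemma Vball_EFin x r : (Vball mu x r)%:E = mu (ball x r).
Proof. by rewrite fineK// ball_fin_num. Qed.

Lemma Vball_ge0 x r : 0 <= Vball mu x r.
Proof. by rewrite fine_ge0. Qed.

Lemma Vball_gt0 x r : 0 < r -> 0 < Vball mu x r.
Proof. by move=> r0; rewrite -lte_fin Vball_EFin; have /andP[] := mu_balls x r0. Qed.

Lemma subset_Vball x y r s : ball x r `<=` ball y s -> Vball mu x r <= Vball mu y s.
Proof.
move=> xy; rewrite -lee_fin !Vball_EFin.
by apply: le_measure => //; apply: mem_set; exact: measurable_metric_ball.
Qed.

(** Centres within [N] of a fixed point whose balls have mass at least [1 / (k + 1)] are finite in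
    number, since these disjoint balls lie in one ball of finite measure. As all masses are
    positive, such classes exhaust [E]. *)
Lemma disjoint_balls_countable (E : set X) e : 0 < e ->
  trivIset E (fun x => ball x e) -> countable E.
Proof.
move=> e0 tE; have [->|/set0P[z Ez]] := eqVneq E set0; first exact: countable0.
pose F (N k : nat) := [set x | [/\ E x, mdist z x < N%:R & k.+1%:R^-1 <= Vball mu x e]].
rewrite (_ : E = \bigcup_N \bigcup_k F N k); last first.
  apply/seteqP; split => [x Ex|x [N _ [k _ []]]//].
  have x0 := Vball_gt0 x e0.
  exists (Num.trunc (mdist z x)).+1 => //; exists (Num.trunc (Vball mu x e)^-1) => //.
  split=> //; first by rewrite truncnS_gt.
  by rewrite -[leRHS]invrK lef_pV2 ?posrE ?invr_gt0// ltW// truncnS_gt.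
apply: bigcup_countable => // N _; apply: bigcup_countable => // k _.
apply: finite_set_countable; apply: contrapT => Finf.
pose M := Vball mu z (N%:R + e).
(* A finite subfamily with more than [M * (k + 1)] members would have total mass above [M]. *)
have [B BF] := infinite_set_fset (Num.trunc (M * k.+1%:R)).+1 Finf.
apply/negP; rewrite -ltnNge -(@ltr_nat R); apply: le_lt_trans (truncnS_gt _).
rewrite -ler_pdivrMr//.
have tB : trivIset [set` B] (fun x => ball x e).
  by apply: sub_trivIset tE => x /BF[].
have := @measure_fin_bigcup _ _ _ mu _ [set` B] (fun x => ball x e)
  (finite_fset B) tB (fun i _ => measurable_metric_ball i e).
move=> sumB.
have : ((\sum_(i \in [set` B]) (k.+1%:R^-1 : R)%:E)%R <= M%:E)%E.
  apply: (@le_trans _ _ (\sum_(i \in [set` B]) mu (ball i e))%R).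
    by apply: lee_fsum => // i /BF[_ _]; rewrite -lee_fin Vball_EFin.
  rewrite -sumB /M Vball_EFin le_measure ?inE//.
  - apply/mem_set/fin_bigcup_measurable => // i _.
    exact: measurable_metric_ball.
  - exact/mem_set/measurable_metric_ball.
  move=> y [x /= /BF[_ zx _]]; apply: subset_ball_mdist.
  by rewrite lerD2r ltW.
rewrite fsbig_finite//= set_fsetK sumEFin lee_fin big_const_seq count_predT.
by rewrite iter_addr_0 -[leLHS]mulr_natl.
Qed.

(** The centres of maximal disjoint families of balls of radius [1 / (n + 1)], taken over all [n],
    form a countable dense set. The point [x0] excludes the empty space, where no sequence
    exists. *)
Lemma dense_sequence x0 :
  exists q : nat -> X, forall x e, 0 < e -> exists n, mdist x (q n) < e.
Proof.
pose D (n : nat) := sval (ex_maximal_disjoint_subcollection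
  (fun x => ball x (n.+1%:R^-1)) [set: X]).
have DP n : maximal_disjoint_subcollection
    (fun x => ball x (n.+1%:R^-1)) (D n) [set: X].
  exact: (svalP (ex_maximal_disjoint_subcollection _ _)).
have cD : countable (\bigcup_n D n).
  apply: bigcup_countable => // n _; have [_ + _] := DP n.
  exact: disjoint_balls_countable.
have hD x n : exists2 s, D n s & mdist x s < 2 / n.+1%:R.
  have [_ tD maxD] := DP n.
  (* A point at distance at least [2 / (n + 1)] from every centre could be added to the family,
     against maximality. *)
  apply: contrapT => /forall2NP hx.
  have xD : ~ D n x.
    by move=> Dx; case: (hx x) => //; apply; rewrite mdistxx divr_gt0.
  apply: (maxD (D n `|` [set x])) => //.
    split; last by move=> /(_ x (or_intror erefl)).
    by move=> s; left.
  have hxs (s : X) : D n s -> ball x n.+1%:R^-1 `&` ball s n.+1%:R^-1 = set0.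
    move=> Ds; rewrite -subset0 => w []; rewrite !in_ballE => xw sw.
    case: (hx s) => //; apply; rewrite (le_lt_trans (metric_triangle x w s))//.
    by rewrite mulrDl mul1r ltrD// metric_sym.
  move=> i j [Di|->] [Dj|->] //; first exact: tD.
    by move=> [w [wi wx]]; have := hxs i Di; rewrite -subset0 => /(_ w); case.
  by move=> [w [wx wj]]; have := hxs j Dj; rewrite -subset0 => /(_ w); case.
have /pfcard_geP[D0|[q]] := cD.
  have [s Ds _] := hD x0 0%N; suff : set0 s by [].
  by rewrite -D0; exists 0%N.
exists q => x e e0; pose n := Num.trunc (2 / e).
have [s Ds xs] := hD x n.
have [m _ qm] := @surj _ _ _ _ q s (ex_intro2 _ _ n I Ds).
exists m; rewrite qm.
rewrite (lt_trans xs)// ltr_pdivrMr// mulrC -ltr_pdivrMr//.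
exact: truncnS_gt.
Qed.

(* The product sigma-algebra contains the open sets because balls of positive
   and finite measure make the space separable. *)
Lemma measurable_prod_open (O : set (X * X)) :
  (forall x y, O (x, y) -> exists2 e, 0 < e &
    forall x' y', mdist x x' < e -> mdist y y' < e -> O (x', y')) ->
  measurable O.
Proof.
move=> oO; have [->|/set0P[[x0 _] _]] := eqVneq O set0; first exact: measurable0.
have [q qP] := dense_sequence x0.
pose U (i : nat * nat * nat) : set (X * X) :=
  ball (q i.1.1) (i.2.+1%:R^-1) `*` ball (q i.1.2) (i.2.+1%:R^-1).
pose I := [set i | U i `<=` O].
rewrite (_ : O = \bigcup_(i in I) U i); last first.
  apply/seteqP; split => [[x y] Oxy|w [i Ii /Ii//]].
  have [e e0 eO] := oO _ _ Oxy.
  (* This [n] gives [2 / (n + 1) < e], so a product of two basic balls of radius [1 / (n + 1)]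
     containing [(x, y)] stays inside [O]. *)
  pose n := Num.trunc (2 / e).
  have n0 : 0 < n.+1%:R^-1 :> R by [].
  have ne : n.+1%:R^-1 + n.+1%:R^-1 < e.
    rewrite -mulr2n -[ltLHS]mulr_natl ltr_pdivrMr// mulrC -ltr_pdivrMr//.
    exact: truncnS_gt.
  have [i xi] := qP x _ n0; have [j yj] := qP y _ n0.
  exists (i, j, n); last by split; rewrite /= in_ballE metric_sym.
  move=> [x' y'] [/=]; rewrite !in_ballE => x'i y'j; apply: eO.
    by rewrite (le_lt_trans (metric_triangle _ (q i) _))// (lt_trans _ ne)// ltrD.
  by rewrite (le_lt_trans (metric_triangle _ (q j) _))// (lt_trans _ ne)// ltrD.
rewrite bigcup_mkcond; apply: countable_bigcupT_measurable => // i.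
by case: ifP => // _; apply: measurableX; exact: measurable_metric_ball.
Qed.

(* [Vdist] is lower semicontinuous. *)
Lemma measurable_Vdist : measurable_fun setT (fun w : X * X => Vdist mu w.1 w.2).
Proof.
apply: (measurability _ (RGenOInfty.measurableE R)) => //.
move=> _ [_ [a ->] <-]; rewrite setTI; apply: measurable_prod_open => x y /=.
rewrite in_itv/= andbT /Vdist; set r := mdist x y => ar.
(* These balls increase to the open ball [ball x r], so by continuity from below one of them already
   has measure above [a]. *)
pose B : (set X)^nat := fun n => ball x (r - n.+1%:R^-1).
have BE : \bigcup_n B n = ball x r.
  apply/seteqP; split => [w [n _]|w].
    by apply: subset_ball_mdist; rewrite mdistxx add0r lerBlDr lerDl.
  rewrite in_ballE -subr_gt0 => rw; exists (Num.trunc (r - mdist x w)^-1) => //.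
  rewrite /B in_ballE ltrBrDr -ltrBrDl -[ltRHS]invrK ltf_pV2 ?posrE ?invr_gt0//.
  exact: truncnS_gt.
have := @nondecreasing_cvg_mu _ _ _ mu B.
rewrite BE => /(_ (fun n => measurable_metric_ball _ _) (measurable_metric_ball _ _)).
have ndB : nondecreasing_seq B.
  move=> m n mn; apply/subsetPset/subset_ball_mdist.
  by rewrite mdistxx add0r lerB// lef_pV2 ?posrE// ler_nat.
move=> /(_ ndB) cvgB.
have [n] : exists n, (a%:E < mu (B n))%E.
  apply: contrapT => /forallNP aB; move: ar.
  rewrite -lte_fin Vball_EFin ltNge => /negP; apply.
  rewrite -(cvg_lim _ cvgB)//; apply: lime_le; first by apply/cvg_ex; eexists; exact: cvgB.
  by apply: nearW => n; rewrite leNgt; exact/negP/aB.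
rewrite -Vball_EFin lte_fin => an.
(* A third of the gap is what fits: placing [B n] in the ball about [x'] of radius [mdist x' y']
   counts the displacement of [x] twice and that of [y] once. *)
exists (n.+1%:R^-1 / 3) => [|x' y' xx' yy']; first by rewrite divr_gt0.
rewrite in_itv/= andbT (lt_le_trans an)//; apply/subset_Vball/subset_ball_mdist.
rewrite metric_sym; have := metric_triangle x x' y; have := metric_triangle x' y' y.
rewrite -/r (metric_sym y' y).
move: xx' yy'; set u := n.+1%:R^-1.
lra.
Qed.

(* On the diagonal the quotient is [0 / 0 = 0]. *)
Lemma besov_integrandE p f (w : X * X) : 0 < p ->
  besov_integrand mu p f w = `|f w.1 - f w.2| `^ p / Vdist mu w.1 w.2 ^+ 2.
Proof.
move=> p0; rewrite /besov_integrand; case: eqP => // ->.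
by rewrite subrr normr0 powR0 ?gt_eqF// mul0r.
Qed.

Lemma besov_integrand_ge0 p f (w : X * X) : 0 <= besov_integrand mu p f w.
Proof.
rewrite /besov_integrand; case: ifP => // _.
by rewrite divr_ge0 ?powR_ge0 ?exprn_ge0 ?Vball_ge0.
Qed.

Lemma measurable_besov_integrand p f : 0 < p -> measurable_fun setT f ->
  measurable_fun setT (besov_integrand mu p f).
Proof.
move=> p0 mf; rewrite (_ : besov_integrand mu p f = fun w : X * X =>
  `|f w.1 - f w.2| `^ p * (Vdist mu w.1 w.2 ^+ 2)^-1); last first.
  by apply/funext => w; rewrite besov_integrandE.
apply: measurable_funM.
  apply: (@measurableT_comp _ _ _ _ _ _ (@powR R ^~ p)) => //.
  apply: measurableT_comp => //.
  by apply: measurable_funB; apply: measurableT_comp.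
rewrite (_ : (fun _ => _) = fun w => (Vdist mu w.1 w.2 ^+ 2) `^ (-1)); last first.
  by apply/funext => w; rewrite powR_inv1// exprn_ge0// Vball_ge0.
apply: (@measurableT_comp _ _ _ _ _ _ (@powR R ^~ (-1))) => //.
by apply: measurable_funX; exact: measurable_Vdist.
Qed.

Lemma measurable_mdist_lt e : measurable [set w : X * X | mdist w.1 w.2 < e].
Proof.
apply: measurable_prod_open => x y /= xye.
exists ((e - mdist x y) / 2); first by rewrite divr_gt0// subr_gt0.
move=> x' y' xx' yy'.
have := metric_triangle x' x y'; have := metric_triangle x y y'.
by rewrite (metric_sym x' x); lra.
Qed.

Lemma sigma_finite_balls : sigma_finite setT mu.
Proof.
have [X0|/set0P[z _]] := eqVneq [set: X] set0.
  exists (fun=> set0); first by rewrite X0 bigcup_const//; exists 0%N.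
  by move=> _; rewrite measure0.
exists (fun n => ball z n%:R); last first.
  by move=> n; split; [exact: measurable_metric_ball|rewrite -ge0_fin_numE// ball_fin_num].
apply/seteqP; split => // x _; exists (Num.trunc (mdist z x)).+1 => //.
by rewrite in_ballE truncnS_gt.
Qed.

End ball_measure.

(** * Averages against a Lipschitz kernel, and mean oscillation *)

Section mollifier.
Context (disp : measure_display) (R : realType) (X : borelMetricType disp R).
Variable mu : {measure set X -> \bar R}.
Hypothesis mu_balls : balls_pos_finite mu.
Implicit Types (x y z : X) (r s t e M d : R) (f g h : X -> R).

Definition oscillation f x s : R :=
  (Vball mu x s)^-1 * \int[mu]_(y in ball x s) `|f y - f x|.

(** A cone instead of an indicator: it is 1-Lipschitz in the centre [x], which makes the averages
    Lipschitz, while it still vanishes off [ball x (2 * t)] and is at least [t] on [ball x t]. *)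
Definition bump t x y : R := Num.max 0 (2 * t - mdist x y).

Definition bump_mass t x : R := \int[mu]_y bump t x y.

Definition mollify t f x : R := (\int[mu]_y (bump t x y * f y)) / bump_mass t x.

Lemma integrable_bounded_ball h x s M : measurable_fun setT h ->
  (forall y, `|h y| <= M) -> mu.-integrable (ball x s) (EFin \o h).
Proof.
move=> mh hM; apply: measurable_bounded_integrable.
- exact: measurable_metric_ball.
- by rewrite -ge0_fin_numE// ball_fin_num.
- exact: measurable_funTS.
- exists M; split; first exact: num_real.
  by move=> M' /ltW MM' y _; exact: le_trans (hM y) MM'.
Qed.

Lemma norm_Rintegral_ball_le h g x s M :
  measurable_fun setT h -> measurable_fun setT g -> (forall y, `|g y| <= M) ->
  (forall y, `|h y| <= g y) ->
  `|\int[mu]_(y in ball x s) h y| <= \int[mu]_(y in ball x s) g y.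
Proof.
move=> mh mg gM hg.
have hM y : `|h y| <= M by rewrite (le_trans (hg y))// (le_trans _ (gM y))// ler_norm.
have mB := measurable_metric_ball x s.
apply: le_trans (le_normr_Rintegral mB (integrable_bounded_ball _ _ mh hM)) _.
apply: le_Rintegral => //.
- apply: (@integrable_bounded_ball (fun y => `|h y|) _ _ M).
    exact: measurableT_comp.
  by move=> y; rewrite normr_id.
- exact: integrable_bounded_ball gM.
Qed.

Lemma Rintegral_support (D : set X) h : (forall y, ~ D y -> h y = 0) ->
  \int[mu]_y h y = \int[mu]_(y in D) h y.
Proof.
move=> hD; rewrite [RHS]Rintegral_mkcond; apply: eq_Rintegral => y _.
by rewrite patchE; case: ifPn => // /negP yD; apply: hD => /mem_set.
Qed.

Lemma bump_ge0 t x y : 0 <= bump t x y.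
Proof. by rewrite /bump le_max lexx. Qed.

Lemma bump_le t x y : 0 < t -> `|bump t x y| <= 2 * t.
Proof.
move=> t0; rewrite ger0_norm ?bump_ge0// /bump; case: (leP 0) => _.
  by rewrite gerBl mdist_ge0.
by rewrite mulr_ge0// ltW.
Qed.

Lemma bump_eq0 t x y : ~ ball x (2 * t) y -> bump t x y = 0.
Proof.
rewrite in_ballE => /negP; rewrite -leNgt => xy.
by apply/max_idPl; rewrite subr_le0.
Qed.

Lemma bump_ge t x y : ball x t y -> t <= bump t x y.
Proof.
rewrite in_ballE => xy; rewrite /bump le_max; apply/orP; right; lra.
Qed.

Lemma bump_lipschitz t x x' y : `|bump t x y - bump t x' y| <= mdist x x'.
Proof.
have := mdist_lipschitz y x x'; rewrite ![mdist y _]metric_sym ler_norml => /andP[? ?].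
have := mdist_ge0 x x'.
rewrite /bump ler_norml => ?; apply/andP.
by case: (leP 0 (2 * t - mdist x y)); case: (leP 0 (2 * t - mdist x' y)) => ? ?; split; lra.
Qed.

Lemma measurable_bump t x : measurable_fun setT (bump t x).
Proof.
apply: measurable_maxr => //; apply: measurable_funB => //.
exact: measurable_mdist.
Qed.

Lemma measurable_bumpM t x f :
  measurable_fun setT f -> measurable_fun setT (fun y => bump t x y * f y).
Proof. by move=> mf; apply: measurable_funM => //; exact: measurable_bump. Qed.

Lemma bumpM_le t x f M : 0 < t -> (forall y, `|f y| <= M) ->
  forall y, `|bump t x y * f y| <= 2 * t * M.
Proof. by move=> t0 fM y; rewrite normrM ler_pM// bump_le. Qed.

Lemma oscillation_le f x s M : 0 < s -> measurable_fun setT f ->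
  (forall y, `|f y| <= M) -> oscillation f x s <= 2 * M.
Proof.
move=> s0 mf fM; rewrite /oscillation ler_pdivrMl ?Vball_gt0//.
have fxM y : `|f y - f x| <= 2 * M.
  by rewrite (le_trans (ler_normB _ _))// mulr_natl mulr2n lerD.
rewrite mulrC -Rintegral_cst; last exact: measurable_metric_ball.
apply: le_Rintegral => //; first exact: measurable_metric_ball.
- apply: (@integrable_bounded_ball (fun y => `|f y - f x|) _ _ (2 * M)).
    by apply: measurableT_comp => //; apply: measurable_funB.
  by move=> y; rewrite normr_id.
- exact: (@integrable_bounded_ball (cst (2 * M)) _ _ `|2 * M|).
Qed.

Lemma oscillation_ge0 f x s : 0 <= oscillation f x s.
Proof. by rewrite mulr_ge0 ?invr_ge0 ?Vball_ge0 ?Rintegral_ge0. Qed.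

(** * Estimates for the averages under doubling *)

Section estimates.
Variables (c t M : R) (f : X -> R).
Hypothesis mu_c : forall x r, 0 < r -> (mu (ball x (2 * r)) <= c%:E * mu (ball x r))%E.
Hypothesis t0 : 0 < t.
Hypothesis mf : measurable_fun setT f.
Hypothesis fM : forall y, `|f y| <= M.

Lemma Vball_doubling x r : 0 < r -> Vball mu x (2 * r) <= c * Vball mu x r.
Proof. by move=> r0; rewrite -lee_fin EFinM !Vball_EFin//; exact: mu_c. Qed.

(** The ball of radius [3 * t] about [x] lies in that of radius [4 * t] about [x'], which is two
    doublings away from [t]. *)
Lemma Vball_3t x x' : mdist x x' <= t -> Vball mu x (3 * t) <= c ^+ 2 * Vball mu x' t.
Proof.
move=> xx'.
have c0 : 0 <= c.
  rewrite -(pmulr_lge0 _ (Vball_gt0 mu_balls x t0)).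
  exact: le_trans (Vball_ge0 _ _ _) (Vball_doubling x t0).
apply: (@le_trans _ _ (Vball mu x' (2 * (2 * t)))).
  by apply/subset_Vball/subset_ball_mdist => //; rewrite metric_sym; lra.
apply: le_trans (Vball_doubling _ _) _; first by rewrite mulr_gt0.
by rewrite expr2 -mulrA ler_wpM2l// Vball_doubling.
Qed.

(** The support of the kernel at [x'] stays in the ball about [x], so the averages at [x] and at all
    nearby [x'] become integrals over one common ball. *)
Lemma bump_mass_ball x x' : mdist x x' <= t ->
  bump_mass t x' = \int[mu]_(y in ball x (3 * t)) bump t x' y.
Proof.
move=> xx'; apply: Rintegral_support => y xy; apply: bump_eq0 => x'y; apply: xy.
by apply: subset_ball_mdist x'y; lra.
Qed.

Lemma bump_mass_ge x : t * Vball mu x t <= bump_mass t x.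
Proof.
have xx : mdist x x <= t by rewrite mdistxx ltW.
have mB := measurable_metric_ball x t.
rewrite (bump_mass_ball xx) -Rintegral_cst//.
have -> : ball x t = ball x (3 * t) `&` ball x t.
  rewrite setIidr//; apply: subset_ball_mdist.
  by rewrite mdistxx add0r ler_peMl ?ler1n// ltW.
rewrite Rintegral_mkcondr; apply: le_Rintegral.
- exact: measurable_metric_ball.
- apply: (@integrable_bounded_ball _ _ _ t).
    by apply/(measurable_restrictT _ mB).
  by move=> y; rewrite patchE; case: ifP => _; rewrite ?normr0 ?gtr0_norm// ltW.
- apply: (@integrable_bounded_ball _ _ _ (2 * t)); first exact: measurable_bump.
  by move=> y; exact: bump_le.
- move=> y _; rewrite patchE; case: ifPn => [/set_mem|_]; last exact: bump_ge0.
  exact: bump_ge.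
Qed.

Lemma bump_mass_gt0 x : 0 < bump_mass t x.
Proof. by apply: lt_le_trans (bump_mass_ge x); rewrite mulr_gt0// Vball_gt0. Qed.

(** Used as an upper bound [c ^+ 2 / (t * V)] for the inverse of the mass, with the same [V] for all
    [x'] near [x]. *)
Lemma bump_mass_doubling x x' : mdist x x' <= t ->
  t * Vball mu x (3 * t) <= c ^+ 2 * bump_mass t x'.
Proof.
move=> xx'; apply: (@le_trans _ _ (t * (c ^+ 2 * Vball mu x' t))).
  by rewrite ler_wpM2l ?Vball_3t// ltW.
by rewrite mulrCA ler_wpM2l ?sqr_ge0// bump_mass_ge.
Qed.

(** Averaging reproduces constants, so [f x] can be moved under the integral, even for the average
    taken at [x']. This brings in the oscillation at [x]. *)
Lemma mollify_subE x x' : mdist x x' <= t ->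
  mollify t f x' - f x =
  (\int[mu]_(y in ball x (3 * t)) (bump t x' y * (f y - f x))) / bump_mass t x'.
Proof.
move=> xx'; have W0 := bump_mass_gt0 x'.
have mB := measurable_metric_ball x (3 * t).
apply: (mulIf (lt0r_neq0 W0)); rewrite mulrBl /mollify !divfK ?gt_eqF//.
rewrite (@Rintegral_support (ball x (3 * t))); last first.
  move=> y xy; rewrite bump_eq0 ?mul0r// => x'y; apply: xy.
  by apply: subset_ball_mdist x'y; lra.
have ib : mu.-integrable (ball x (3 * t)) (EFin \o bump t x').
  apply: (@integrable_bounded_ball _ _ _ (2 * t)); first exact: measurable_bump.
  by move=> y; exact: bump_le.
rewrite (bump_mass_ball xx') -RintegralZl//.
rewrite -RintegralB//; last 2 first.
- apply: integrable_bounded_ball (bumpM_le _ t0 fM); exact: measurable_bumpM.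
- exact: (integrableZl mB (f x) ib).
by apply: eq_Rintegral => y _; rewrite mulrBr (mulrC (f x)).
Qed.

Lemma measurable_sub_cst x : measurable_fun setT (fun y => f y - f x).
Proof. exact: measurable_funB. Qed.

Lemma sub_cst_le x y : `|f y - f x| <= 2 * M.
Proof. by rewrite (le_trans (ler_normB _ _))// mulr_natl mulr2n lerD. Qed.

(** Serves two weights: the kernel itself, bounded by [2 * t], and the difference of two kernels,
    bounded by the distance of their centres. *)
Lemma weighted_sub_le x (w : X -> R) a : measurable_fun setT w -> 0 <= a ->
  (forall y, `|w y| <= a) ->
  `|\int[mu]_(y in ball x (3 * t)) (w y * (f y - f x))| <=
  a * (Vball mu x (3 * t) * oscillation f x (3 * t)).
Proof.
move=> mw a0 wa.
have V0 : Vball mu x (3 * t) != 0 by rewrite gt_eqF// Vball_gt0// mulr_gt0.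
rewrite /oscillation mulVKf//.
have mn : measurable_fun setT (fun y => `|f y - f x|).
  by apply: measurableT_comp => //; exact: measurable_sub_cst.
rewrite -RintegralZl//; last 2 first.
- exact: measurable_metric_ball.
- apply: integrable_bounded_ball mn _ => y.
  by rewrite normr_id; exact: sub_cst_le.
apply: (@norm_Rintegral_ball_le _ _ _ _ (a * (2 * M))).
- apply: measurable_funM => //; exact: measurable_sub_cst.
- exact: measurable_funM.
- by move=> y; rewrite normrM normr_id ger0_norm// ler_wpM2l// sub_cst_le.
- by move=> y; rewrite normrM ler_wpM2r.
Qed.

Lemma mollify_sub_le x :
  `|mollify t f x - f x| <= 2 * c ^+ 2 * oscillation f x (3 * t).
Proof.
have xx : mdist x x <= t by rewrite mdistxx ltW.
have W0 := bump_mass_gt0 x.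
rewrite mollify_subE// normrM normfV (gtr0_norm W0) ler_pdivrMr//.
have := @weighted_sub_le x (bump t x) (2 * t) (measurable_bump t x).
move=> /(_ _ (fun y => bump_le _ _ t0)) h; apply: le_trans (h _) _.
  by rewrite mulr_ge0// ltW.
rewrite [leLHS](_ : _ = 2 * oscillation f x (3 * t) * (t * Vball mu x (3 * t))); last by ring.
rewrite [leRHS](_ : _ = 2 * oscillation f x (3 * t) * (c ^+ 2 * bump_mass t x)); last by ring.
by rewrite ler_wpM2l ?bump_mass_doubling// mulr_ge0 ?oscillation_ge0.
Qed.

Lemma mollify_le x : `|mollify t f x| <= M.
Proof.
have xx : mdist x x <= t by rewrite mdistxx ltW.
have W0 := bump_mass_gt0 x.
rewrite /mollify normrM normfV (gtr0_norm W0) ler_pdivrMr//.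
rewrite (@Rintegral_support (ball x (3 * t))); last first.
  move=> y xy; rewrite bump_eq0 ?mul0r// => x'y; apply: xy.
  by apply: subset_ball_mdist x'y; lra.
rewrite (bump_mass_ball xx).
have M0 : 0 <= M by exact: le_trans (fM x).
rewrite -RintegralZl//; last 2 first.
- exact: measurable_metric_ball.
- apply: (@integrable_bounded_ball _ _ _ (2 * t)); first exact: measurable_bump.
  by move=> y; exact: bump_le.
apply: (@norm_Rintegral_ball_le _ _ _ _ (M * (2 * t))).
- exact: measurable_bumpM.
- by apply: measurable_funM => //; exact: measurable_bump.
- by move=> y; rewrite normrM (ger0_norm M0) ler_wpM2l// bump_le.
- by move=> y; rewrite normrM mulrC ler_pM// ger0_norm// bump_ge0.
Qed.

(** Both averages minus [f x] are quotients, [A / W] and [A' / W']. Their difference splits into a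
    change of numerator, which yields the term [c ^+ 2], and a change of denominator, which uses two
    inverse masses and yields [2 * c ^+ 4]. *)
Lemma mollify_local_lipschitz x x' : mdist x x' <= t ->
  `|mollify t f x - mollify t f x'| <=
  (c ^+ 2 + 2 * c ^+ 4) * oscillation f x (3 * t) / t * mdist x x'.
Proof.
move=> xx'; have xx : mdist x x <= t by rewrite mdistxx ltW.
have [W0 W'0] := (bump_mass_gt0 x, bump_mass_gt0 x').
have [WV W'V] := (bump_mass_doubling xx, bump_mass_doubling xx').
have V0 : 0 < Vball mu x (3 * t) by rewrite Vball_gt0// mulr_gt0.
have := mollify_subE xx'; have := mollify_subE xx.
set A := Rintegral _ _ _; set A' := Rintegral _ _ _ => Ex Ex'.
have r0 : 0 <= mdist x x' := mdist_ge0 x x'.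
have o0 := oscillation_ge0 f x (3 * t).
have AA' : `|A - A'| <= mdist x x' * (Vball mu x (3 * t) * oscillation f x (3 * t)).
  rewrite /A /A' -RintegralB; last 3 first.
  - exact: measurable_metric_ball.
  - apply: integrable_bounded_ball (bumpM_le _ t0 (sub_cst_le x)).
    by apply: measurable_bumpM; exact: measurable_sub_cst.
  - apply: integrable_bounded_ball (bumpM_le _ t0 (sub_cst_le x)).
    by apply: measurable_bumpM; exact: measurable_sub_cst.
  under eq_Rintegral do rewrite -mulrBl.
  apply: weighted_sub_le => //; last by move=> y; exact: bump_lipschitz.
  by apply: measurable_funB; exact: measurable_bump.
have A'le : `|A'| <= 2 * t * (Vball mu x (3 * t) * oscillation f x (3 * t)).
  apply: weighted_sub_le; first exact: measurable_bump.
    by rewrite mulr_ge0// ltW.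
  by move=> y; exact: bump_le.
have WW' : `|bump_mass t x' - bump_mass t x| <= mdist x x' * Vball mu x (3 * t).
  rewrite (bump_mass_ball xx) (bump_mass_ball xx') distrC.
  rewrite -Rintegral_cst ?measurable_metric_ball; last exact: measurable_metric_ball.
  rewrite -RintegralB; last 3 first.
  - exact: measurable_metric_ball.
  - apply: (@integrable_bounded_ball _ _ _ (2 * t)); first exact: measurable_bump.
    by move=> y; exact: bump_le.
  - apply: (@integrable_bounded_ball _ _ _ (2 * t)); first exact: measurable_bump.
    by move=> y; exact: bump_le.
  apply: (@norm_Rintegral_ball_le _ _ _ _ (mdist x x')) => //.
  - by apply: measurable_funB; exact: measurable_bump.
  - by move=> y; rewrite ger0_norm.
  - by move=> y; exact: bump_lipschitz.
rewrite (_ : mollify t f x - mollify t f x' = (A - A') / bump_mass t x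
   + A' * (bump_mass t x' - bump_mass t x) / (bump_mass t x * bump_mass t x')); last first.
  rewrite -(subrK (f x) (mollify t f x)) -(subrK (f x) (mollify t f x')) Ex Ex'.
  by field; rewrite !gt_eqF.
set W := bump_mass t x in W0 WV WW' *; set W' := bump_mass t x' in W'0 W'V WW' *.
set V := Vball mu x (3 * t) in V0 WV W'V AA' A'le WW'.
set o := oscillation f x (3 * t) in o0 AA' A'le *.
set r := mdist x x' in r0 AA' WW' *.
have tV : 0 < t * V by rewrite mulr_gt0.
apply: le_trans (ler_normD _ _) _.
rewrite [leRHS](_ : _ = r * (V * o) * (c ^+ 2 / (t * V)) +
    2 * t * (V * o) * (r * V) * ((c ^+ 2 / (t * V)) * (c ^+ 2 / (t * V)))); last first.
  by field; rewrite !gt_eqF.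
have iW : W^-1 <= c ^+ 2 / (t * V).
  by rewrite ler_pdivlMr// mulrC ler_pdivrMr.
have iW' : W'^-1 <= c ^+ 2 / (t * V).
  by rewrite ler_pdivlMr// mulrC ler_pdivrMr.
apply: lerD.
  by rewrite normrM normfV (gtr0_norm W0) ler_pM// invr_ge0 ltW.
rewrite normrM normfV (gtr0_norm (mulr_gt0 W0 W'0)) invfM.
apply: ler_pM => //; first by rewrite mulr_ge0// invr_ge0 ltW.
  by rewrite normrM ler_pM.
by rewrite ler_pM// invr_ge0 ltW.
Qed.

(** Up to distance [t] the local estimate applies with oscillation at most [2 * M]. Beyond [t] the
    values differ by at most [2 * M], and [mdist x y / t] is at least 1; the [+ 1] lets the same
    constant cover this case. *)
Lemma mollify_lipschitz : lipschitz_fun (mollify t f).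
Proof.
exists ((c ^+ 2 + 2 * c ^+ 4 + 1) * (2 * M) / t) => x y.
have M0 : 0 <= M by exact: le_trans (fM x).
have c20 : 0 <= c ^+ 2 by rewrite sqr_ge0.
have c40 : 0 <= c ^+ 4 by rewrite (_ : 4 = 2 * 2)%N// exprM sqr_ge0.
have [xy|/ltW xy] := leP (mdist x y) t.
  apply: le_trans (mollify_local_lipschitz xy) _.
  rewrite ler_wpM2r ?mdist_ge0// ler_wpM2r ?invr_ge0 ?(ltW t0)//.
  apply: ler_pM; rewrite ?oscillation_ge0//; [lra|lra|].
  by apply: oscillation_le => //; rewrite mulr_gt0.
apply: (@le_trans _ _ (2 * M)).
  by rewrite (le_trans (ler_normB _ _))// mulr_natl mulr2n lerD ?mollify_le.
have q1 : 1 <= mdist x y / t by rewrite ler_pdivlMr// mul1r.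
rewrite [leRHS](_ : _ = 2 * M * ((c ^+ 2 + 2 * c ^+ 4 + 1) * (mdist x y / t))); last by ring.
rewrite ler_peMr ?mulr_ge0//; apply: le_trans q1 _; rewrite ler_peMl//; last lra.
by rewrite divr_ge0 ?mdist_ge0// ltW.
Qed.

Lemma lip_mollify_le x :
  (lip (mollify t f) x <=
   ((c ^+ 2 + 2 * c ^+ 4) * oscillation f x (3 * t) / t)%:E)%E.
Proof.
have c20 : 0 <= c ^+ 2 by rewrite sqr_ge0.
have c40 : 0 <= c ^+ 4 by rewrite (_ : 4 = 2 * 2)%N// exprM sqr_ge0.
apply: (lip_le t0); last by move=> y; exact: mollify_local_lipschitz.
by rewrite divr_ge0 ?(ltW t0)// mulr_ge0 ?oscillation_ge0//; lra.
Qed.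

End estimates.

(** The graph of the convex function [u]^
    d[lies above its tangent at]a[. This is Young's inequality for]u[and]a [^ (d - 1)] with
    exponents [d] and [d / (d - 1)]; the case [d = 1], without a finite conjugate exponent, is
    separate. *)
Lemma powR_tangent (a u d : R) : 0 <= a -> 0 <= u -> 1 <= d ->
  d * a `^ (d - 1) * u <= u `^ d + (d - 1) * a `^ d.
Proof.
move=> a0 u0; rewrite le_eqVlt => /predU1P[<-|d1].
  by rewrite subrr powRr0 mul0r addr0 !mul1r powRr1.
have d0 : 0 < d by rewrite (lt_trans _ d1).
have d10 : 0 < d - 1 by rewrite subr_gt0.
have := @conjugate_powR _ u (a `^ (d - 1)) d (d / (d - 1)) u0 (powR_ge0 _ _) d0.
rewrite divr_gt0// => /(_ isT).
rewrite -powRrM mulrCA divff ?gt_eqF// mulr1 invf_div => h.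
have /h : d^-1 + (d - 1) / d = 1 by field; rewrite gt_eqF.
rewrite -(ler_pM2l d0) mulrA mulrAC => /le_trans; apply.
by rewrite le_eqVlt; apply/orP; left; apply/eqP; field; rewrite !gt_eqF.
Qed.

(* Jensen's inequality, by integrating the tangent bound at the mean. *)
Lemma oscillation_powR_le f x s M d : 0 < s -> 1 <= d -> measurable_fun setT f ->
  (forall y, `|f y| <= M) ->
  oscillation f x s `^ d * Vball mu x s <=
  \int[mu]_(y in ball x s) `|f y - f x| `^ d.
Proof.
move=> s0 d1 mf fM; have d0 : 0 < d by rewrite (lt_le_trans _ d1).
have V0 := Vball_gt0 mu_balls x s0.
have mB := measurable_metric_ball x s.
have a0 := oscillation_ge0 f x s.
have fxM y : `|f y - f x| <= 2 * M.
  by rewrite (le_trans (ler_normB _ _))// mulr_natl mulr2n lerD.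
have mn : measurable_fun setT (fun y => `|f y - f x|).
  by apply: measurableT_comp => //; apply: measurable_funB.
have inrm : mu.-integrable (ball x s) (EFin \o (fun y => `|f y - f x|)).
  by apply: (integrable_bounded_ball _ _ mn (M := 2 * M)) => y; rewrite normr_id.
have ipow : mu.-integrable (ball x s) (EFin \o (fun y => `|f y - f x| `^ d)).
  apply: (@integrable_bounded_ball _ _ _ ((2 * M) `^ d)).
    exact: (@measurableT_comp _ _ _ _ _ _ (@powR R ^~ d)).
  move=> y; rewrite ger0_norm ?powR_ge0// ge0_ler_powR ?nnegrE ?(ltW d0)//.
  exact: le_trans (fxM y).
have icst k : mu.-integrable (ball x s) (EFin \o cst k).
  exact: (@integrable_bounded_ball (cst k) _ _ `|k|).
set a := oscillation f x s in a0 *.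
have := @le_Rintegral _ _ _ mu (ball x s) (fun y => d * a `^ (d - 1) * `|f y - f x|)
  (fun y => `|f y - f x| `^ d + (d - 1) * a `^ d) mB.
have -> : \int[mu]_(y in ball x s) (d * a `^ (d - 1) * `|f y - f x|) =
    d * a `^ d * Vball mu x s.
  rewrite RintegralZl// -(mulr_powRB1 a0 d0).
  have -> : \int[mu]_(y in ball x s) `|f y - f x| = Vball mu x s * a.
    by rewrite /a /oscillation mulVKf// gt_eqF.
  by ring.
rewrite RintegralD//; last exact: icst.
rewrite Rintegral_cst// => h.
have : d * a `^ d * Vball mu x s <=
    \int[mu]_(y in ball x s) `|f y - f x| `^ d + (d - 1) * a `^ d * Vball mu x s.
  apply: h.
  - exact: (integrableZl mB (d * a `^ (d - 1)) inrm).
  - exact: (integrableD mB ipow (icst _)).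
  - by move=> y _; exact: powR_tangent.
by rewrite -lerBlDr -mulrBl -mulrBl opprB addrC subrK mul1r.
Qed.

End mollifier.

(* Unlike [ge0_le_integral], no measurability is required: it is applied to
   [f := lip _ `^ d], whose measurability is never established. *)
Lemma ge0_le_integral_nonmeas (disp : measure_display) (T : measurableType disp)
    (R : realType) (mu : {measure set T -> \bar R}) (D : set T) (f g : T -> \bar R) :
  (forall x, D x -> (0 <= f x)%E) -> (forall x, D x -> (f x <= g x)%E) ->
  (\int[mu]_(x in D) f x <= \int[mu]_(x in D) g x)%E.
Proof.
move=> f0 fg; rewrite integral_mkcond [leRHS]integral_mkcond.
have fgD x : ((f \_ D) x <= (g \_ D) x)%E by apply: lee_restrict.
have fD0 x : (0 <= (f \_ D) x)%E by apply: erestrict_ge0.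
rewrite !ge0_integralTE//; last by move=> x; exact: le_trans (fgD x).
apply: le_ereal_sup => _ [h hf <-]; exists h => // x.
exact: le_trans (hf x) (fgD x).
Qed.

(** * Tail integrals near the diagonal and their decay *)

Section tails.
Context (disp : measure_display) (R : realType) (X : borelMetricType disp R).
Variable mu : {sigma_finite_measure set X -> \bar R}.
Hypothesis mu_balls : balls_pos_finite mu.
Variable G : X * X -> R.
Hypothesis mG : measurable_fun setT G.
Hypothesis G0 : forall w, 0 <= G w.
Implicit Types (x y z : X) (r s t e M d : R) (f : X -> R).

Definition tail s x : \bar R := (\int[mu]_(y in ball x s) (G (x, y))%:E)%E.

(** The ball becomes a section of a measurable neighbourhood of the diagonal, so that Tonelli's
    theorem gives measurability in [x]. *)
Lemma tailE s x :
  tail s x = (\int[mu]_y (G (x, y) * \1_[set w : X * X | (mdist w.1 w.2 < s)%R] (x, y))%:E)%E.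
Proof.
rewrite /tail integral_mkcond; apply: eq_integral => y _.
rewrite patchE indicE.
case: ifPn => [/set_mem|/negP xy].
  by rewrite in_ballE => xy; rewrite mem_set// mulr1.
by rewrite memNset ?mulr0// => xy'; apply: xy; apply: mem_set; rewrite in_ballE.
Qed.

Lemma measurable_sectionG x : measurable_fun setT (fun y => G (x, y)).
Proof. by apply: measurableT_comp => //; exact: measurable_fun_pair. Qed.

Lemma measurable_tail s : measurable_fun setT (tail s).
Proof.
rewrite (_ : tail s = fubini_F mu (fun w => (G w *
  \1_[set w : X * X | (mdist w.1 w.2 < s)%R] w)%:E)); last first.
  by apply/funext => x; rewrite tailE.
apply: measurable_fun_fubini_tonelli_F.
  apply/measurable_EFinP; apply: measurable_funM => //.
  apply: measurable_indic; exact: (measurable_mdist_lt mu_balls).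
by move=> w; rewrite lee_fin mulr_ge0.
Qed.

Definition section_mass x : \bar R := (\int[mu]_y (G (x, y))%:E)%E.

Lemma measurable_section_mass : measurable_fun setT section_mass.
Proof.
apply: (measurable_fun_fubini_tonelli_F (fun w => (G w)%:E)).
  exact/measurable_EFinP.
by move=> w; rewrite lee_fin.
Qed.

Lemma tail_ge0 s x : (0 <= tail s x)%E.
Proof. by apply: integral_ge0 => y _; rewrite lee_fin. Qed.

Lemma tail_le s x : (tail s x <= section_mass x)%E.
Proof.
apply: ge0_subset_integral => //; first exact: measurable_metric_ball.
  by apply/measurable_EFinP; exact: measurable_sectionG.
by move=> y _; rewrite lee_fin.
Qed.

(** Jensen's inequality leaves a factor [Vball mu x s] on the left, and [Vdist] is at most
    [Vball mu x s] on the ball, which puts its square on the right; one power cancels. *)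
Lemma oscillation_tail_le f x s d M : 0 < s -> 1 <= d ->
  measurable_fun setT f -> (forall y, `|f y| <= M) ->
  (forall y, ball x s y -> `|f y - f x| `^ d <= Vdist mu x y ^+ 2 * G (x, y)) ->
  ((oscillation mu f x s `^ d)%:E <= (Vball mu x s)%:E * tail s x)%E.
Proof.
move=> s0 d1 mf fM fG; have V0 := Vball_gt0 mu_balls x s0.
have mB := measurable_metric_ball x s.
have d0 : 0 <= d by rewrite (le_trans _ d1).
have ipow : mu.-integrable (ball x s) (EFin \o (fun y => `|f y - f x| `^ d)).
  apply: (@integrable_bounded_ball _ _ _ mu mu_balls _ _ _ ((2 * M) `^ d)).
    apply: (@measurableT_comp _ _ _ _ _ _ (@powR R ^~ d)) => //.
    by apply: measurableT_comp => //; apply: measurable_funB.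
  have fxM y : `|f y - f x| <= 2 * M.
    by rewrite (le_trans (ler_normB _ _))// mulr_natl mulr2n lerD.
  move=> y; rewrite ger0_norm ?powR_ge0// ge0_ler_powR ?nnegrE//.
  exact: le_trans (fxM y).
have h : ((\int[mu]_(y in ball x s) `|f y - f x| `^ d)%:E <=
    (Vball mu x s ^+ 2)%:E * tail s x)%E.
  rewrite /Rintegral fineK; last exact: integrable_fin_num.
  rewrite /tail -ge0_integralZl_EFin//; last 3 first.
  - by move=> y _; rewrite lee_fin.
  - by apply/measurable_EFinP; apply: measurable_funTS; exact: measurable_sectionG.
  - by rewrite sqr_ge0.
  apply: ge0_le_integral_nonmeas => y xy; first by rewrite lee_fin powR_ge0.
  rewrite -EFinM lee_fin; apply: le_trans (fG y xy) _.
  rewrite ler_wpM2r// ler_sqr ?nnegrE ?Vball_ge0//.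
  apply: subset_Vball => //; apply: subset_ball_mdist.
  by rewrite mdistxx add0r ltW//; move: xy; rewrite in_ballE.
have := oscillation_powR_le mu_balls x s0 d1 mf fM; rewrite -lee_fin.
move=> /le_trans/(_ h) {}h.
have Vi0 : (0 <= ((Vball mu x s)^-1)%:E)%E by rewrite lee_fin invr_ge0 ltW.
have := lee_wpmul2l Vi0 h.
rewrite muleA -!EFinM mulrCA mulVf ?gt_eqF// mulr1.
by rewrite expr2 mulrA mulVf ?gt_eqF// mul1r.
Qed.

Section convergence.
Variable s : R^nat.
Hypothesis s_cvg0 : s @ \oo --> 0.
Hypothesis Gdiag : forall x, G (x, x) = 0.
Hypothesis total_lty : (\int[mu]_x section_mass x < +oo)%E.

Lemma integrable_section_mass : mu.-integrable setT section_mass.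
Proof.
apply/integrableP; split; first exact: measurable_section_mass.
rewrite (eq_integral section_mass) // => x _; rewrite gee0_abs// integral_ge0// => y _.
by rewrite lee_fin.
Qed.

(** Dominated convergence in [y] with majorant [G (x, y)]. Off the diagonal the cutoff is eventually
    0; at [y = x] it need not be, and [Gdiag] handles a possible atom there. *)
Lemma tail_cvg0 x : (section_mass x < +oo)%E -> tail (s n) x @[n --> \oo] --> 0%E.
Proof.
move=> tx.
have := @dominated_convergence _ _ _ mu setT measurableT
  (fun n y => (G (x, y) * \1_[set w : X * X | (mdist w.1 w.2 < s n)%R] (x, y))%:E)
  (cst 0%E) (fun y => (G (x, y))%:E).
case.
- move=> n; apply/measurable_EFinP; apply: measurable_funM.
    exact: measurable_sectionG.
  apply: (@measurableT_comp _ _ _ _ _ _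
    (\1_[set w : X * X | (mdist w.1 w.2 < s n)%R] : _ -> R)).
    apply: measurable_indic; exact: (measurable_mdist_lt mu_balls).
  exact: measurable_fun_pair.
- exact: measurable_cst.
- apply: aeW => y _; have [<-|xy] := eqVneq x y.
    by under eq_fun do rewrite Gdiag mul0r; exact: cvg_cst.
  apply: cvg_near_cst; have : 0 < mdist x y by rewrite mdist_gt0.
  move=> /(cvgr_lt 0 s_cvg0); apply: filterS => n sn.
  by rewrite indicE memNset ?mulr0//= => /(lt_trans sn); rewrite ltxx.
- apply/integrableP; split; first by apply/measurable_EFinP; exact: measurable_sectionG.
  by under eq_integral do rewrite gee0_abs ?lee_fin//.
- apply: aeW => y n _; rewrite lee_fin ger0_norm ?mulr_ge0//.
  by rewrite ler_piMr// indicE; case: (_ \in _).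
move=> _ _; rewrite integral_cst// mul0e; apply: cvg_trans; apply: near_eq_cvg.
by apply: nearW => n; rewrite tailE.
Qed.

Lemma ae_section_mass_lty : {ae mu, forall x, (section_mass x < +oo)%E}.
Proof.
have := integrable_ae measurableT integrable_section_mass.
by apply: filterS => x /(_ I); rewrite fin_numE ltey => /andP[].
Qed.

(** A second dominated convergence, now in [x], with majorant [section_mass]. *)
Lemma integral_tail_cvg0 : (\int[mu]_x tail (s n) x)%E @[n --> \oo] --> 0%E.
Proof.
have := @dominated_convergence _ _ _ mu setT measurableT
  (fun n x => tail (s n) x) (cst 0%E) section_mass.
case.
- by move=> n; exact: measurable_tail.
- exact: measurable_cst.
- by apply: filterS ae_section_mass_lty => x tx _; exact: tail_cvg0.
- exact: integrable_section_mass.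
- by apply: aeW => x n _; rewrite gee0_abs ?tail_ge0// tail_le.
by move=> _ _; rewrite integral_cst// mul0e.
Qed.

End convergence.
End tails.

Lemma ecvg0_lt (R : realType) (u : nat -> \bar R) (e : R) :
  u n @[n --> \oo] --> 0%E -> 0 < e -> \forall n \near \oo, (u n < e%:E)%E.
Proof.
move=> /fine_cvgP[ufin u0] e0; near=> n.
rewrite -[u n]fineK ?lte_fin; last by near: n.
by near: n; exact: (cvgr_lt 0 u0).
Unshelve. all: by end_near. Qed.

(** * Stability of the mean oscillation under perturbation in L^1 *)

Section mean_oscillation.
Context (disp : measure_display) (R : realType) (X : borelMetricType disp R).
Variable mu : {measure set X -> \bar R}.
Hypothesis mu_balls : balls_pos_finite mu.

(** Passing from [f] to [g] changes both the function and its average, each at the cost of one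
    integral of [|g - f|]; hence the factor 2. *)
Lemma mean_oscillation_le (f g : X -> R) (M r : R) (z : X) : 0 < r ->
  measurable_fun setT f -> measurable_fun setT g ->
  (forall y, `|f y| <= M) -> (forall y, `|g y| <= M) ->
  \int[mu]_(y in ball z r) `|f y - ball_average mu f z r| <=
  \int[mu]_(y in ball z r) `|g y - ball_average mu g z r| +
  2 * \int[mu]_(y in ball z r) `|g y - f y|.
Proof.
move=> r0 mf mg fM gM; have V0 := Vball_gt0 mu_balls z r0.
have mB := measurable_metric_ball z r.
have mabs (h : X -> R) a :
    measurable_fun setT h -> measurable_fun setT (fun y => `|h y - a|).
  by move=> mh; apply: measurableT_comp => //; apply: measurable_funB.
have iabs (h : X -> R) a : measurable_fun setT h -> (forall y, `|h y| <= M) ->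
    mu.-integrable (ball z r) (EFin \o (fun y => `|h y - a|)).
  move=> mh hM; apply: (@integrable_bounded_ball _ _ _ mu mu_balls _ _ _ (M + `|a|)).
    exact: mabs.
  by move=> y; rewrite normr_id (le_trans (ler_normB _ _))// lerD.
have mgf : measurable_fun setT (fun y => `|g y - f y|).
  by apply: measurableT_comp => //; apply: measurable_funB.
have gfM y : `|g y - f y| <= 2 * M.
  by rewrite (le_trans (ler_normB _ _))// mulr_natl mulr2n lerD.
have igf : mu.-integrable (ball z r) (EFin \o (fun y => `|g y - f y|)).
  by apply: (integrable_bounded_ball mu_balls _ _ mgf (M := 2 * M)) => y; rewrite normr_id.
have icst k : mu.-integrable (ball z r) (EFin \o cst k).
  exact: (integrable_bounded_ball mu_balls _ _ (measurable_cst k) (M := `|k|)).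
set a := ball_average mu f z r; set b := ball_average mu g z r.
set e := \int[mu]_(y in ball z r) `|g y - f y|.
have ab : `|b - a| <= (Vball mu z r)^-1 * e.
  rewrite /a /b /ball_average -mulrBr normrM ger0_norm ?invr_ge0 ?(ltW V0)//.
  rewrite ler_pM2l ?invr_gt0// -RintegralB//; last 2 first.
  - exact: integrable_bounded_ball gM.
  - exact: integrable_bounded_ball fM.
  apply: (norm_Rintegral_ball_le mu_balls _ _ (M := 2 * M)) => //.
  - by apply: measurable_funB.
  - by move=> y; rewrite normr_id.
apply: (@le_trans _ _ (\int[mu]_(y in ball z r)
    (`|g y - b| + (`|g y - f y| + (Vball mu z r)^-1 * e)))).
  apply: le_Rintegral => //.
  - exact: iabs.
  - exact: (integrableD mB (iabs g b mg gM) (integrableD mB igf (icst _))).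
  - move=> y _; apply: (@le_trans _ _ (`|g y - b| + (`|g y - f y| + `|b - a|))).
      rewrite [in leLHS](_ : f y - a = (g y - b) + ((f y - g y) + (b - a))); last by ring.
      rewrite (le_trans (ler_normD _ _))// lerD2l (le_trans (ler_normD _ _))//.
      by rewrite distrC.
    by rewrite !lerD2l.
rewrite RintegralD//; last 2 first.
- exact: iabs.
- exact: (integrableD mB igf (icst _)).
rewrite lerD2l RintegralD//; last exact: icst.
rewrite Rintegral_cst// -/(Vball mu z r) mulrAC mulVf ?gt_eqF// mul1r -/e.
by rewrite mulr_natl mulr2n.
Qed.

End mean_oscillation.

(** * Bounded functions on one ball: the limit in the Poincaré inequality *)

Section bounded_function.
Context (disp : measure_display) (R : realType) (X : borelMetricType disp R).
Variable mu : {sigma_finite_measure set X -> \bar R}.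
Hypothesis mu_balls : balls_pos_finite mu.
Variables (c d A rho lambda cP r M : R) (z : X).
Hypothesis mu_c : forall x r, 0 < r -> (mu (ball x (2 * r)) <= c%:E * mu (ball x r))%E.
Hypothesis d1 : 1 <= d.
Hypothesis r0 : 0 < r.
Hypothesis lambda1 : 1 <= lambda.
Hypothesis cP0 : 0 < cP.
Hypothesis poincare_zr : forall F, lipschitz_fun F ->
  ((Vball mu z r)^-1%:E *
     \int[mu]_(x in ball z r) `|F x - ball_average mu F z r|%:E
   <= (cP * r)%:E *
      ((Vball mu z (lambda * r))^-1%:E *
        \int[mu]_(x in ball z (lambda * r)) (lip F x `^ d)) `^ d^-1)%E.
Hypothesis rho0 : 0 < rho.
Hypothesis A0 : 0 <= A.
Hypothesis upper_V : forall x s, ball z (lambda * r) x -> 0 < s -> s <= rho ->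
  Vball mu x s <= A * s `^ d.
(* [G] is a majorant of the Besov quotient, cut off to a large ball. *)
Variables (f : X -> R) (G : X * X -> R).
Hypothesis mf : measurable_fun setT f.
Hypothesis fM : forall y, `|f y| <= M.
Hypothesis mG : measurable_fun setT G.
Hypothesis G0 : forall w, 0 <= G w.
Hypothesis Gdiag : forall x, G (x, x) = 0.
Hypothesis total_lty : (\int[mu]_x section_mass mu G x < +oo)%E.
Hypothesis fG : forall x y, ball z (lambda * r) x -> ball x rho y ->
  `|f y - f x| `^ d <= Vdist mu x y ^+ 2 * G (x, y).

Let d0 : 0 < d. Proof. exact: lt_le_trans d1. Qed.

(** The scales are indexed by the radius [s n = 3 * t n] of the oscillation balls, which must not
    exceed [rho] for [upper_V] and [fG] to apply. *)
Let s (n : nat) : R := rho / n.+1%:R.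
Let t (n : nat) : R := s n / 3.
Let F n := mollify mu (t n) f.

Let s_gt0 n : 0 < s n. Proof. by rewrite divr_gt0. Qed.
Let t_gt0 n : 0 < t n. Proof. by rewrite divr_gt0. Qed.
Let s_le n : s n <= rho.
Proof. by rewrite ler_pdivrMr// ler_peMr ?ler1n// ltW. Qed.
Let t3 n : 3 * t n = s n. Proof. by rewrite mulrC divfK. Qed.

Let s_cvg0 : s @ \oo --> 0.
Proof.
rewrite -(mulr0 rho); apply: cvgM; first exact: cvg_cst.
exact: cvg_harmonic.
Qed.

Let cst_ge0 : 0 <= c ^+ 2 + 2 * c ^+ 4.
Proof. by rewrite addr_ge0 ?sqr_ge0// mulr_ge0// (_ : 4 = 2 * 2)%N// exprM sqr_ge0. Qed.

Let oscillation_tail n x : ball z (lambda * r) x ->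
  ((oscillation mu f x (s n) `^ d)%:E <= (A * s n `^ d)%:E * tail mu G (s n) x)%E.
Proof.
move=> zx; apply: le_trans (_ : _ <= (Vball mu x (s n))%:E * tail mu G (s n) x)%E _.
  apply: (oscillation_tail_le mu_balls mG G0 (s_gt0 n) d1 mf fM) => y xy.
  apply: fG => //; apply: subset_ball_mdist xy.
  by rewrite mdistxx add0r.
by rewrite lee_wpmul2r ?tail_ge0// lee_fin upper_V.
Qed.

Let lip_F_le n x : ball z (lambda * r) x ->
  (lip (F n) x `^ d <=
   ((3 * (c ^+ 2 + 2 * c ^+ 4)) `^ d * A)%:E * tail mu G (s n) x)%E.
Proof.
move=> zx; have o0 := oscillation_ge0 mu f x (s n).
have := lip_mollify_le mu_balls mu_c (t_gt0 n) mf fM x; rewrite t3 => lipF.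
apply: (@le_trans _ _ (((c ^+ 2 + 2 * c ^+ 4) * oscillation mu f x (s n) / t n)%:E `^ d)%E).
  apply: gt0_ler_poweR => //; first exact: ltW.
    by rewrite in_itv/= lip_ge0 leey.
  rewrite in_itv/= leey andbT lee_fin.
  by apply: divr_ge0; [exact: mulr_ge0|exact: ltW].
rewrite poweR_EFin.
rewrite (_ : _ / t n = 3 * (c ^+ 2 + 2 * c ^+ 4) * oscillation mu f x (s n) * (s n)^-1);
  last by rewrite /t; field; rewrite gt_eqF.
have K0 : 0 <= 3 * (c ^+ 2 + 2 * c ^+ 4) by apply: mulr_ge0.
have i0 : 0 <= (s n)^-1 by rewrite invr_ge0 ltW.
rewrite (powRM _ (mulr_ge0 K0 o0) i0) (powRM _ K0 o0).
rewrite mulrAC EFinM; apply: le_trans (lee_wpmul2l _ (oscillation_tail n zx)) _.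
  by rewrite lee_fin; apply: mulr_ge0; exact: powR_ge0.
rewrite muleA -EFinM lee_wpmul2r ?tail_ge0// lee_fin.
rewrite -mulrA ler_wpM2l ?powR_ge0// mulrCA -(powRM _ i0 (ltW (s_gt0 n))).
by rewrite mulVf ?gt_eqF// powR1 mulr1.
Qed.

Let F_cvg x : ball z (lambda * r) x -> (section_mass mu G x < +oo)%E ->
  F n x @[n --> \oo] --> f x.
Proof.
move=> zx tx; apply/cvgrPdist_le => e e0.
pose h := e / (2 * c ^+ 2 + 1).
have c0 : 0 < 2 * c ^+ 2 + 1 by rewrite ltr_wpDl// mulr_ge0// sqr_ge0.
have h0 : 0 < h by rewrite divr_gt0.
have B0 : 0 < A * rho `^ d + 1 by rewrite ltr_wpDl// mulr_ge0// powR_ge0.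
have hd0 : 0 < h `^ d / (A * rho `^ d + 1) by rewrite divr_gt0// powR_gt0.
have := ecvg0_lt (tail_cvg0 mu_balls mG G0 s_cvg0 Gdiag tx) hd0.
apply: filterS => n tn.
have oh : oscillation mu f x (s n) <= h.
  rewrite leNgt; apply/negP => ho.
  have : ((oscillation mu f x (s n) `^ d)%:E <= (h `^ d)%:E)%E.
    apply: le_trans (oscillation_tail n zx) _.
    apply: (@le_trans _ _ ((A * rho `^ d)%:E * (h `^ d / (A * rho `^ d + 1))%:E)%E).
      apply: lee_pmul => //; rewrite ?tail_ge0 ?lee_fin ?mulr_ge0 ?powR_ge0 ?(ltW tn)//.
      by rewrite ler_wpM2l// ge0_ler_powR ?nnegrE ?(ltW d0) ?(ltW rho0) ?(ltW (s_gt0 n)).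
    rewrite -EFinM lee_fin mulrCA ler_piMr ?powR_ge0// ler_pdivrMr// mul1r.
    by rewrite lerDl.
  by rewrite lee_fin leNgt gt0_ltr_powR ?nnegrE ?oscillation_ge0 ?(ltW h0).
rewrite distrC; apply: le_trans (mollify_sub_le mu_balls mu_c (t_gt0 n) mf fM x) _.
rewrite t3; apply: (@le_trans _ _ ((2 * c ^+ 2 + 1) * h)).
  apply: ler_pM oh; [|exact: oscillation_ge0|by rewrite lerDl].
  by rewrite mulr_ge0// sqr_ge0.
by rewrite mulrC divfK// gt_eqF.
Qed.

Let mF n : measurable_fun setT (F n).
Proof. exact/lipschitz_measurable/(mollify_lipschitz mu_balls mu_c (t_gt0 n) mf fM). Qed.

Let FM n x : `|F n x| <= M.
Proof. exact: (mollify_le mu_balls (t_gt0 n) mf fM). Qed.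

Let subset_zr : ball z r `<=` ball z (lambda * r).
Proof. by apply: subset_ball_mdist; rewrite mdistxx add0r ler_peMl// ltW. Qed.

Let L1_cvg : (\int[mu]_(y in ball z r) `|F n y - f y|%:E)%E @[n --> \oo] --> 0%E.
Proof.
have mB := measurable_metric_ball z r.
have := @dominated_convergence _ _ _ mu (ball z r) mB
  (fun n y => (F n y)%:E) (fun y => (f y)%:E) (cst M%:E).
case => //.
- by move=> n; apply/measurable_EFinP; exact: measurable_funTS.
- by apply/measurable_EFinP; exact: measurable_funTS.
- have := ae_section_mass_lty mG G0 total_lty.
  apply: filterS => y ty zy; apply: cvg_EFin; first exact: nearW.
  by apply: F_cvg => //; exact: subset_zr.
- exact: (integrable_bounded_ball mu_balls _ _ (measurable_cst M) (M := `|M|)).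
- by apply: aeW => y n _; rewrite lee_fin.
Qed.

Let integral_lip_cvg :
  (\int[mu]_(x in ball z (lambda * r)) (lip (F n) x `^ d))%E @[n --> \oo] --> 0%E.
Proof.
set B := (3 * (c ^+ 2 + 2 * c ^+ 4)) `^ d * A.
have B0 : 0 <= B by rewrite mulr_ge0// powR_ge0.
apply: (@squeeze_cvge _ _ _ _ (cst 0%E) _
  (fun n => (B%:E * \int[mu]_x tail mu G (s n) x)%E)).
- apply: nearW => n; apply/andP; split.
    by apply: integral_ge0 => x _; exact: poweR_ge0.
  rewrite -ge0_integralZl_EFin//; last 2 first.
  - by move=> x _; exact: tail_ge0.
  - exact: measurable_tail.
  apply: (@le_trans _ _ (\int[mu]_(x in ball z (lambda * r)) (B%:E * tail mu G (s n) x))%E).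
    apply: ge0_le_integral_nonmeas => x zx; first exact: poweR_ge0.
    exact: lip_F_le.
  apply: ge0_subset_integral => //; first exact: measurable_metric_ball.
    apply: measurable_funeM; exact: measurable_tail.
  by move=> x _; rewrite mule_ge0 ?tail_ge0// lee_fin.
- exact: cvg_cst.
- rewrite -(mule0 B%:E); apply: cvgeZl => //.
  exact: integral_tail_cvg0.
Qed.

Lemma mean_oscillation_eq0 :
  \int[mu]_(x in ball z r) `|f x - ball_average mu f z r| = 0.
Proof.
apply/eqP; rewrite eq_le Rintegral_ge0// andbT.
have V0 := Vball_gt0 mu_balls z r0.
have L0 : 0 < lambda * r by rewrite mulr_gt0// (lt_le_trans _ lambda1).
have VL0 := Vball_gt0 mu_balls z L0.
have mB := measurable_metric_ball z r.
apply/ler_addgt0Pl => e e0; rewrite addr0.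
have e30 : 0 < e / 3 by rewrite divr_gt0.
(* Chosen so that the Poincaré bound [Vball mu z r * (cP * r) * h] equals [e / 3]; the threshold
   [hd0] then makes the mean of [lip (F n)]^ d[at most]h [^ d]. *)
pose h := e / 3 / (Vball mu z r * (cP * r)).
have h0 : 0 < h by rewrite divr_gt0// !mulr_gt0.
have hd0 : 0 < Vball mu z (lambda * r) * h `^ d by rewrite mulr_gt0// powR_gt0.
have [n [L1n lipn]] := filter_ex (filterI (ecvg0_lt L1_cvg e30)
  (ecvg0_lt integral_lip_cvg hd0)).
apply: le_trans (mean_oscillation_le mu_balls z r0 mf (mF n) fM (FM n)) _.
(* One third pays for the oscillation of [F n], the other two for replacing [f] by [F n]. *)
have -> : e = e / 3 + 2 * (e / 3) by field.
apply: lerD; last first.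
  rewrite ler_wpM2l// -lee_fin /Rintegral fineK ?(ltW L1n)//.
  rewrite ge0_fin_numE; first exact: lt_trans L1n (ltry _).
  by apply: integral_ge0 => y _; rewrite lee_fin.
have := poincare_zr (mollify_lipschitz mu_balls mu_c (t_gt0 n) mf fM).
rewrite -/(F n); set P := (\int[mu]_(x in ball z r) _)%E.
set J := (\int[mu]_(x in ball z _) _)%E => PJ.
have P0 : (0 <= P)%E by apply: integral_ge0 => y _; rewrite lee_fin.
have J0 : (0 <= J)%E by apply: integral_ge0 => y _; exact: poweR_ge0.
have Jh : ((((Vball mu z (lambda * r))^-1)%:E * J) `^ d^-1 <= h%:E)%E.
  apply: (@le_trans _ _ ((h `^ d)%:E `^ d^-1)%E); last first.
    by rewrite poweR_EFin -powRrM mulfV ?gt_eqF// powRr1// ltW.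
  have Vi0 : (0 <= ((Vball mu z (lambda * r))^-1)%:E)%E by rewrite lee_fin invr_ge0 ltW.
  rewrite gt0_ler_poweR ?invr_ge0 ?(ltW d0)// ?in_itv/= ?leey ?andbT;
    rewrite ?mule_ge0 ?lee_fin ?powR_ge0//.
  apply: le_trans (lee_wpmul2l Vi0 (ltW lipn)) _.
  by rewrite -EFinM mulrA mulVf ?gt_eqF// mul1r.
have PV : (P <= (e / 3)%:E)%E.
  have cPr : (0 <= (cP * r)%:E)%E by rewrite lee_fin mulr_ge0// ltW.
  have := le_trans PJ (lee_wpmul2l cPr Jh).
  rewrite lee_pdivrMl// -!EFinM => /le_trans; apply; rewrite lee_fin.
  by rewrite mulrA /h mulrC divfK// gt_eqF// !mulr_gt0.
rewrite -lee_fin /Rintegral fineK ?PV// ge0_fin_numE//.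
exact: le_lt_trans PV (ltry _).
Qed.

End bounded_function.

(** * A bounded injective change of values *)

Section squash.
Context {R : realFieldType}.
Implicit Types u v : R.

Definition squash u : R := u / (1 + `|u|).

Let den_gt0 u : 0 < 1 + `|u|. Proof. by rewrite ltr_pwDl. Qed.

Lemma squash_le1 u : `|squash u| <= 1.
Proof.
rewrite /squash normrM normfV (gtr0_norm (den_gt0 u)) ler_pdivrMr// mul1r.
by rewrite lerDr.
Qed.

Lemma squash_lipschitz u v : `|squash u - squash v| <= 2 * `|u - v|.
Proof.
have [u0 v0] := (den_gt0 u, den_gt0 v).
have -> : squash u - squash v =
    ((u - v) * (1 + `|v|) + v * (`|v| - `|u|)) / ((1 + `|u|) * (1 + `|v|)).
  by rewrite /squash; field; rewrite !gt_eqF.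
rewrite normrM normfV (gtr0_norm (mulr_gt0 u0 v0)) ler_pdivrMr ?mulr_gt0//.
apply: (@le_trans _ _ (`|u - v| * (1 + `|v|) + `|v| * `|u - v|)).
  apply: le_trans (ler_normD _ _) _; rewrite !normrM (gtr0_norm v0) lerD2l.
  by rewrite ler_wpM2l// distrC (le_trans (ler_dist_dist _ _)).
have := normr_ge0 u; have := normr_ge0 v; have := normr_ge0 (u - v).
move: `|u| `|v| `|u - v| => a b e e0 b0 a0.
have : 0 <= e * a by rewrite mulr_ge0.
have : 0 <= e * (a * b) by rewrite !mulr_ge0.
by lra.
Qed.

(** The map [v / (1 - |v|)] is a left inverse. Injectivity later carries constancy back from
    [squash \o f] to [f]. *)
Lemma squash_inj : injective squash.
Proof.
have squashK u : squash u / (1 - `|squash u|) = u.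
  have u0 := den_gt0 u.
  rewrite /squash normrM normfV (gtr0_norm u0).
  have -> : 1 - `|u| / (1 + `|u|) = (1 + `|u|)^-1 by field; rewrite gt_eqF.
  by rewrite invrK divfK// gt_eqF.
by move=> u v uv; rewrite -(squashK u) -(squashK v) uv.
Qed.

End squash.

(** Of the [d] powers of the difference, [d - p] are bounded by 2 through boundedness and the
    remaining [p] through the Lipschitz bound. This is where [p <= d] enters. *)
Lemma squash_powR_le (R : realType) (p d u v : R) : 0 < p -> p <= d ->
  `|squash u - squash v| `^ d <= 2 `^ d * `|u - v| `^ p.
Proof.
move=> p0 pd; set a := `|squash u - squash v|.
have a2 : a <= 2.
  by rewrite /a (le_trans (ler_normB _ _))// (_ : 2 = 1 + 1)// lerD ?squash_le1.
have a0 : 0 <= a := normr_ge0 _.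
have d0 : 0 < d by exact: lt_le_trans pd.
have [->|aN0] := eqVneq a 0.
  by rewrite powR0 ?gt_eqF// mulr_ge0 ?powR_ge0.
rewrite -{1}(subrK p d) powRD; last by rewrite aN0 implybT.
apply: (@le_trans _ _ (2 `^ (d - p) * (2 * `|u - v|) `^ p)).
  apply: ler_pM; rewrite ?powR_ge0//.
    by rewrite ge0_ler_powR ?nnegrE ?subr_ge0.
  by rewrite ge0_ler_powR ?nnegrE ?(ltW p0) ?mulr_ge0// squash_lipschitz.
rewrite powRM// mulrA -powRD; last by rewrite pnatr_eq0 implybT.
by rewrite subrK.
Qed.

(** Supplies the bundled sigma-finite measure on which Tonelli's theorem is stated, equal to the
    given one. *)
Lemma sigma_finite_measureP (disp : measure_display) (T : measurableType disp)
    (R : realType) (mu : {measure set T -> \bar R}) : sigma_finite setT mu ->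
  exists mu' : {sigma_finite_measure set T -> \bar R}, mu = mu'.
Proof.
move=> sf.
pose H1 := isSFinite.Build _ _ _ _ (sfinite_measure_sigma_finite sf).
pose H2 := isSigmaFinite.Build _ _ _ _ sf.
pose mu' := HB.pack_for (SigmaFiniteMeasure.type T R) (Measure.sort mu) H1 H2.
by exists mu'; exact: eq_measure.
Qed.

(** * From balls to the whole space, from bounded to general functions, and the Besov space *)

Section main.
Context (disp : measure_display) (R : realType) (X : borelMetricType disp R).
Variable mu : {sigma_finite_measure set X -> \bar R}.
Hypothesis mu_balls : balls_pos_finite mu.
Implicit Types (f g : X -> R) (p d M : R).

Lemma mean_oscillation_ae f M z r : 0 < r -> measurable_fun setT f ->
  (forall x, `|f x| <= M) ->
  \int[mu]_(x in ball z r) `|f x - ball_average mu f z r| = 0 ->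
  {ae mu, forall x, ball z r x -> f x = ball_average mu f z r}.
Proof.
move=> r0 mf fM; set a := ball_average _ _ _ _ => fa0.
have mB := measurable_metric_ball z r.
have mfa : measurable_fun setT (fun x => f x - a) by apply: measurable_funB.
have ifa : mu.-integrable (ball z r) (EFin \o (fun x => `|f x - a|)).
  apply: (integrable_bounded_ball mu_balls _ _ (M := M + `|a|)).
    exact: measurableT_comp.
  by move=> x; rewrite normr_id (le_trans (ler_normB _ _))// lerD.
have mfaE : measurable_fun (ball z r) (fun x => (f x - a)%:E).
  by apply/measurable_EFinP; exact: measurable_funTS.
have [+ _] := ae_eq_integral_abs mu mB mfaE; case.
  by rewrite -[LHS]fineK ?(integrable_fin_num mB ifa)// -[fine _]/(Rintegral _ _ _) fa0.
move=> N [mN N0 subN]; exists N; split => // x /= xN; apply: subN => /= h.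
apply: xN => zx; have := h zx; rewrite /= => -[] /eqP.
by rewrite subr_eq0 => /eqP.
Qed.

(** The constants on the balls of radius [n + 1] about [z] agree, because all these balls contain
    [ball z 1], which has positive measure. Countably many null sets are then discarded. *)
Lemma ae_constant_balls f z :
  (forall r, 0 < r -> exists a, {ae mu, forall x, ball z r x -> f x = a}) ->
  ae_constant mu f.
Proof.
move=> hf.
have /choice[a ha] : forall n : nat, exists a : R,
    {ae mu, forall x, ball z n.+1%:R x -> f x = a} by move=> n; exact: hf.
have aE n : a n = a 0%N.
  apply: contrapT => an; have := Vball_gt0 mu_balls z (@ltr01 R).
  suff mu0 : mu (ball z 1) = 0%E by rewrite /Vball (congr1 fine mu0) ltxx.
  apply/negligibleP; first exact: measurable_metric_ball.
  have [N [mN N0 subN]] := filterI (ha n) (ha 0%N).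
  exists N; split => // x zx; apply: subN => -[h1 h2].
  apply: an; rewrite -(h1 _) ?(h2 zx)//.
  by apply: subset_ball_mdist zx; rewrite mdistxx add0r ler1n.
exists (a 0%N); have := ae_foralln ha; apply: filterS => x hx.
rewrite -(aE (Num.trunc (mdist z x))); apply: hx.
by rewrite in_ballE truncnS_gt.
Qed.

Lemma bounded_ae_constant d f M (h : X * X -> R) :
  1 <= d -> doubling mu -> lower_dimension mu d -> poincare1 mu d ->
  measurable_fun setT f -> (forall x, `|f x| <= M) ->
  measurable_fun setT h -> (forall w, 0 <= h w) -> (forall x, h (x, x) = 0) ->
  L1loc_prod mu h ->
  (forall x y, `|f x - f y| `^ d <= Vdist mu x y ^+ 2 * h (x, y)) ->
  ae_constant mu f.
Proof.
move=> d1 [c mu_c] [C mu_C] [lambda [cP [lambda1 cP0 mu_P]]] mf fM mh h0 hdiag hL1 fh.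
have d0 : 0 < d by exact: lt_le_trans d1.
(* On a space with at most one point every function is constant. Otherwise the distance [rho] of two
   distinct points is a radius below twice the diameter, as the lower dimension requires. *)
have [[z [y zy]]|allE] := pselect (exists x y : X, x != y); last first.
  have [[z _]|noX] := pselect (exists z : X, True).
    exists (f z); apply: aeW => x; congr f; apply: contrapT => /eqP xz.
    by apply: allE; exists x, z.
  by exists 0; apply: aeW => x; case: noX; exists x.
pose rho := mdist z y; have rho0 : 0 < rho by rewrite mdist_gt0.
have rho_diam : (rho%:E < 2%:E * diameter X)%E.
  apply: (@lt_le_trans _ _ (2%:E * rho%:E)%E).
    by rewrite -EFinM lte_fin ltr_pMl// ltr1n.
  rewrite lee_pmul2l//; apply: ereal_sup_ubound.
  by exists z => //; exists y.
have C0 : 0 <= C.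
  have := mu_C z rho rho rho0 (lexx _) rho_diam.
  rewrite !divff ?gt_eqF ?Vball_gt0// powR1 mulr1; exact: le_trans.
apply: (@ae_constant_balls f z) => r r0; exists (ball_average mu f z r).
apply: (mean_oscillation_ae r0 mf fM).
(* [D] contains [ball x rho] for every [x] in [ball z (lambda * r)], so cutting [h] off outside
   [D]*[D] gives finite total mass and loses no pair that the argument meets. *)
pose D := ball z (lambda * r + rho).
have Lr0 : 0 < lambda * r by rewrite mulr_gt0// (lt_le_trans _ lambda1).
have mD : measurable (D `*` D) by apply: measurableX; exact: measurable_metric_ball.
pose G := h \_ (D `*` D).
have mG : measurable_fun setT G by apply/(measurable_restrictT _ mD); exact: measurable_funTS.
have G0 w : 0 <= G w by rewrite /G patchE; case: ifP.
pose A := C * Vball mu z (lambda * r + rho) / rho `^ d.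
apply: (@mean_oscillation_eq0 _ _ _ _ mu_balls c d A rho lambda cP r M z
  mu_c d1 r0 lambda1 cP0 _ rho0 _ _ f G mf fM mG G0).
- by move=> F lipF; exact: mu_P.
- by rewrite divr_ge0 ?powR_ge0// mulr_ge0// Vball_ge0.
- move=> x s zx s0 srho; have := mu_C x s rho s0 srho rho_diam.
  have Vs0 := Vball_gt0 mu_balls x s0.
  have rd0 : 0 < rho `^ d by rewrite powR_gt0.
  have sd0 : 0 < s `^ d by rewrite powR_gt0.
  rewrite powRM ?invr_ge0 ?(ltW rho0) ?(ltW s0)// mulrA ler_pdivlMr//.
  rewrite -(powR_inv1 (ltW s0)) powRAC (powR_inv1 (ltW sd0)) => h1.
  rewrite /A mulrAC ler_pdivlMr//.
  have h2 : C * Vball mu x rho <= C * Vball mu z (lambda * r + rho).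
    rewrite ler_wpM2l//; apply: subset_Vball => //; apply: subset_ball_mdist.
    by rewrite lerD2r ltW//; move: zx; rewrite in_ballE.
  have h3 := le_trans h1 h2.
  by rewrite -ler_pdivrMr// mulrC [leLHS](_ : _ = rho `^ d / s `^ d * Vball mu x s) //; ring.
- by move=> x; rewrite /G patchE hdiag; case: ifP.
- have GE : (\int[mu]_x section_mass mu G x = \int[mu \x mu]_w (G w)%:E)%E.
    by rewrite fubini_tonelli1//; exact/measurable_EFinP.
  rewrite GE; have Lr : 0 < lambda * r + rho by rewrite addr_gt0.
  have /integrableP[_] := hL1 z _ Lr.
  rewrite integral_mkcond; congr (_ < _)%E; apply: eq_integral => w _.
  by rewrite /G !patchE; case: ifP => //= _; rewrite ger0_norm.
- move=> x w zx xw; have := fh x w; rewrite distrC /G patchE mem_set//; split => /=.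
    by apply: subset_ball_mdist zx; rewrite mdistxx add0r lerDl ltW.
  apply: subset_ball_mdist xw; rewrite lerD2r ltW//.
  by move: zx; rewrite in_ballE.
Qed.

Lemma besov_L1loc_ae_constant p d f : 1 <= d -> doubling mu ->
  lower_dimension mu d -> poincare1 mu d -> 0 < p -> p <= d ->
  measurable_fun setT f -> L1loc_prod mu (besov_integrand mu p f) ->
  ae_constant mu f.
Proof.
move=> d1 dbl low poi p0 pd mf fL1.
pose h w := 2 `^ d * besov_integrand mu p f w.
have mb := measurable_besov_integrand mu_balls p0 mf.
have d0 : 0 < d by exact: lt_le_trans d1.
have msf : measurable_fun setT (squash \o f).
  rewrite /squash; apply: measurable_funM => //.
  rewrite (_ : (fun _ => _) = fun x => (1 + `|f x|) `^ (-1)); last first.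
    by apply/funext => x; rewrite powR_inv1// addr_ge0.
  apply: (@measurableT_comp _ _ _ _ _ _ (@powR R ^~ (-1))) => //.
  by apply: measurable_funD => //; exact: measurableT_comp.
have [] := @bounded_ae_constant d (squash \o f) 1 h d1 dbl low poi msf.
- by move=> x; exact: squash_le1.
- exact: measurable_funM.
- by move=> w; rewrite mulr_ge0 ?powR_ge0 ?besov_integrand_ge0.
- by move=> x; rewrite /h /besov_integrand eqxx mulr0.
- move=> x r r0; have mB := measurable_metric_ball x r.
  have := integrableZl (measurableX mB mB) (2 `^ d) (fL1 x r r0).
  by congr (_.-integrable _ _); apply/funext => w; rewrite /= EFinM.
- move=> x y; apply: le_trans (squash_powR_le _ _ p0 pd) _.
  rewrite /h mulrCA ler_wpM2l ?powR_ge0// /besov_integrand /=.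
  case: eqP => [->|/eqP xy]; first by rewrite subrr normr0 powR0 ?gt_eqF// mulr0.
  by rewrite mulrC divfK// expf_neq0// gt_eqF// Vball_gt0// mdist_gt0.
(* If [a] is not a value of [squash \o f], the almost everywhere equality holds at no point, so the
   whole space is null and any constant serves. *)
move=> a ha; have [[x ax]|nx] := pselect (exists x, squash (f x) = a).
  by exists (f x); apply: filterS ha => y /= ya; apply: squash_inj; rewrite ya.
by exists 0; apply: filterS ha => y ya; case: nx; exists y.
Qed.

Lemma besov_L1loc p f : 0 < p -> measurable_fun setT f ->
  (\int[mu \x mu]_w (besov_integrand mu p f w)%:E < +oo)%E ->
  L1loc_prod mu (besov_integrand mu p f).
Proof.
move=> p0 mf foo x r r0; have mB := measurable_metric_ball x r.
have mb := measurable_besov_integrand mu_balls p0 mf.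
apply: (integrableS measurableT) => //; first exact: measurableX.
apply/integrableP; split; first exact/measurable_EFinP.
under eq_integral do rewrite gee0_abs ?lee_fin ?besov_integrand_ge0//.
exact: foo.
Qed.

Lemma ae_constant_Lloc p f : 0 < p -> measurable_fun setT f ->
  ae_constant mu f -> Lloc mu p f.
Proof.
move=> p0 mf [c fc]; split => // x r r0; have mB := measurable_metric_ball x r.
have m1f : measurable_fun setT (\1_(ball x r) \* f).
  by apply: measurable_funM => //; exact: measurable_indic.
apply/andP; split; apply/mem_set => //=.
(* The norm is the power [p^-1] of the integral, finite as soon as the integral is, also for
   [p < 1]. *)
rewrite /finite_norm unlock; apply: poweR_lty.
apply: (@le_lt_trans _ _ (\int[mu]_y ((`|c| `^ p)%:E * (\1_(ball x r) y)%:E))%E).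
  apply: ae_ge0_le_integral => //.
  - by move=> y _; exact: poweR_ge0.
  - apply: (eq_measurable_fun (fun y => (`|(\1_(ball x r) \* f) y| `^ p)%:E)) => //.
    apply/measurable_EFinP; apply: (@measurableT_comp _ _ _ _ _ _ (@powR R ^~ p)) => //.
    exact: measurableT_comp.
  - by apply/measurable_EFinP; apply: measurable_funM => //; exact: measurable_indic.
  apply: filterS fc => y fy _; rewrite /= fy -EFinM lee_fin indicE.
  by case: (_ \in _); rewrite ?mul1r ?mulr1 ?mul0r ?mulr0 ?normr0 ?powR0 ?gt_eqF.
rewrite ge0_integralZl_EFin ?powR_ge0//; last first.
  by apply/measurable_EFinP; exact: measurable_indic.
by rewrite integral_indic// setIT -Vball_EFin// -EFinM ltry.
Qed.

(** By Tonelli: for almost every [x], both values equal [c] for almost every [y], so almost every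
    section has integral 0. *)
Lemma ae_constant_besov_integral p f : 0 < p -> measurable_fun setT f ->
  ae_constant mu f -> (\int[mu \x mu]_w (besov_integrand mu p f w)%:E = 0)%E.
Proof.
move=> p0 mf [c fc].
have mb := measurable_besov_integrand mu_balls p0 mf.
have b0 w : (0 <= (besov_integrand mu p f w)%:E)%E.
  by rewrite lee_fin besov_integrand_ge0.
have mbE : measurable_fun setT (fun w => (besov_integrand mu p f w)%:E).
  exact/measurable_EFinP.
rewrite fubini_tonelli1//.
rewrite (@ae_eq_integral _ _ _ mu setT (cst 0%E)) ?integral0//.
  exact: measurable_fun_fubini_tonelli_F.
have := fc; apply: filterS => x fx _; rewrite /fubini_F.
rewrite (@ae_eq_integral _ _ _ mu setT (cst 0%E)) ?integral0//.
  by apply/measurable_EFinP; exact: (measurable_sectionG mb).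
apply: filterS fc => y fy _.
by rewrite besov_integrandE//= fx fy subrr normr0 powR0 ?gt_eqF// mul0r.
Qed.

End main.

Theorem corollary4p3 (disp : measure_display) (R : realType)
    (X : borelMetricType disp R) (mu : {measure set X -> \bar R}) (d : R)
    (d_ge1 : 1 <= d)
    (mu_balls : balls_pos_finite mu)
    (mu_doubling : doubling mu)
    (mu_lower_dim : lower_dimension mu d)
    (mu_poincare : poincare1 mu d) :
  (forall (p : R) (f : X -> R), 0 < p -> p <= d ->
     Lloc mu p f -> L1loc_prod mu (besov_integrand mu p f) ->
     ae_constant mu f) /\
  (forall p : R, 0 < p -> p <= d -> besov mu p = constants mu).
Proof.
have [mu' muE] := sigma_finite_measureP (sigma_finite_balls mu_balls).
subst mu.
have ae_cst p f : 0 < p -> p <= d -> Lloc mu' p f ->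
    L1loc_prod mu' (besov_integrand mu' p f) -> ae_constant mu' f.
  by move=> p0 pd [mf _]; exact: (besov_L1loc_ae_constant _ d_ge1).
split=> // p p0 pd; apply/seteqP; split => f.
- move=> [fp fB]; have [mf _] := fp; split => //.
  by apply: (ae_cst p) => //; exact: besov_L1loc.
- move=> [mf fc]; split; first exact: ae_constant_Lloc.
  by rewrite ae_constant_besov_integral.
Qed.
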